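(* If $A,B\in[B(\mathcal H)^n]_1$, then $$\|L_{B,A}\|=\|C_AC_B^{-1}\|,$$ where $C_X:=(\Delta_X\otimes I)(I-R_X)^{-1}$ and $R_X:=X_1^*\otimes R_1+\cdots+X_n^*\otimes R_n$ is the reconstruction operator associated with the $n$-tuple $X=(X_1,\ldots,X_n)\in[B(\mathcal H)^n]_1$. Moreover, if $A,B\in[B(\mathcal H)^n]_1^-$ are such that $A\overset{H}{\prec}B$, then $$\|L_{B,A}\|=\sup_{r\in[0,1)}\|C_{rA}C_{rB}^{-1}\|.$$
   Context: $n$ is a positive integer, $\mathcal H$ is a complex Hilbert space, and $B(\mathcal H)$ is the algebra of bounded linear operators on $\mathcal H$. $[B(\mathcal H)^n]_1^-$ (resp. $[B(\mathcal H)^n]_1$) is the set of $(X_1,\ldots,X_n)\in B(\mathcal H)^n$ with $\|X_1X_1^*+\cdots+X_nX_n^*\|^{1/2}\le 1$ (resp. $<1$). Harnack domination: for $A,B\in[B(\mathcal H)^n]_1^-$ and $c>0$, $A\overset{H}{\prec}_c B$ means that $\mathrm{Re}\,p(A)\le c^2\,\mathrm{Re}\,p(B)$ for every $m\in\mathbb N$ and every noncommutative polynomial with matrix coefficients $p\in\mathbb C[X_1,\ldots,X_n]\otimes M_m$ such that $\mathrm{Re}\,p(X)\ge0$ for all $X\in[B(\mathcal K)^n]_1$, where $\mathcal K$ is an infinite-dimensional Hilbert space ($\mathrm{Re}\,T=\frac12(T+T^* )$). $A\overset{H}{\prec}B$ means $A\overset{H}{\prec}_cB$ for some $c>0$; it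 is known that any two elements of $[B(\mathcal H)^n]_1$ Harnack dominate each other. $\mathbb F_n^+$ is the unital free semigroup on generators $g_1,\ldots,g_n$ with identity $g_0$; $V_\alpha:=V_{i_1}\cdots V_{i_k}$ if $\alpha=g_{i_1}\cdots g_{i_k}$, $V_{g_0}:=I$. A minimal isometric dilation of $T\in[B(\mathcal H)^n]_1^-$ is an $n$-tuple $V$ of isometries on $\mathcal K_T\supseteq\mathcal H$ with $\sum_iV_iV_i^*\le I$, $V_i^*|_{\mathcal H}=T_i^*$ and $\mathcal K_T=\bigvee_{\alpha\in\mathbb F_n^+}V_\alpha\mathcal H$; it is unique up to an isomorphism. If $V$ on $\mathcal K_A$ and $W$ on $\mathcal K_B$ are the minimal isometric dilations of $A$ and $B$ and $A\overset{H}{\prec}B$, then $L_{B,A}:\mathcal K_B\to\mathcal K_A$ denotes the (unique) bounded operator with $L_{B,A}|_{\mathcal H}=I_{\mathcal H}$ and $L_{B,A}W_i=V_iL_{B,A}$, $i=1,\ldots,n$; that is, $L_{B,A}\bigl(\sum_{|\alpha|\le q}W_\alpha h_\alpha\bigr)=\sum_{|\alpha|\le q}V_\alpha h_\alpha$. $F^2(H_n)=\mathbb C1\oplus\bigoplus_{k\ge1}H_n^{\otimes k}$ is the full Fock space of an $n$-dimensional Hilbert space $H_n$ with orthonormal basis $e_1,\ldots,e_n$; $R_i\varphi:=\varphi\otimes e_i$ are the right creation operators on it. $\Delta_X:=(I_{\mathcal H}-\sum_{i=1}^nX_iX_i^* )^{1/2}$. For $X\in[B(\mathcal H)^n]_1$,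 $R_X$ is a strict contraction on $\mathcal H\otimes F^2(H_n)$ and $C_X$ is a bounded invertible operator on $\mathcal H\otimes F^2(H_n)$. *)

(* Defs.v *)
From HB Require Import structures.
From mathcomp Require Import all_boot all_order all_algebra.
From mathcomp Require Import sesquilinear finmap complex.
From mathcomp Require Import all_classical all_reals all_analysis.

Set Implicit Arguments.
Unset Strict Implicit.
Unset Printing Implicit Defensive.

Import Order.TTheory GRing.Theory Num.Theory.
Import numFieldNormedType.Exports.

Local Open Scope classical_set_scope.
Local Open Scope ring_scope.
Local Open Scope complex_scope.

(* A complex Hilbert space: a complete normed space over R[i] whose norm comes
   from an inner product, linear in the first argument and conjugate-linear in
   the second.  Norms take their values in R[i]. *)
HB.mixin Record CompleteNormedModule_isHilbert (R : realType) H
    of CompleteNormedModule R[i] H := {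
  inner : {dot H for Num.Def.conjC};
  inner_norm : forall x : H, inner x x = `|x| ^+ 2
}.

#[short(type="hilbertType")]
HB.structure Definition Hilbert (R : realType) :=
  {H of CompleteNormedModule_isHilbert R H & CompleteNormedModule R[i] H}.

Notation "<( x , y )>" := (inner x y) (at level 0, format "<( x ,  y )>") :
  ring_scope.

Section BoundedOperators.
Context (R : realType).
Implicit Types H K : hilbertType R.

Definition infinite_dimensional H :=
  forall s : seq H, exists x : H, forall c : nat -> R[i],
    x <> \sum_(k < size s) c k *: s`_k.

Definition total_family H (I : Type) (v : I -> H) :=
  closure [set x | exists (s : seq I) (c : I -> R[i]),
                     x = \sum_(k <- s) c k *: v k] = [set: H].

(* Bounded operators are plain functions, so that sums, scalings and
   compositions are the pointwise ones; membership is linearity and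
   continuity. *)
Definition bounded_ops H K : set (H -> K) :=
  [set T | linear T /\ continuous T].

Definition opnorm H K (T : H -> K) : R :=
  sup [set complex.Re `|T x| | x in [set x : H | `|x| <= 1]].

(* The definite descriptions below use [xget 0 P]: the element of [P], when
   there is one; in each case at most one element exists. *)
Definition adjoint H K (T : H -> K) : K -> H :=
  xget 0 [set S | bounded_ops S /\
                  forall x y, <(T x, y)> = <(x, S y)>].

Definition positive_op H (T : H -> H) := forall x : H, 0 <= <(T x, x)>.

Definition sqrt_op H (T : H -> H) : H -> H :=
  xget 0 [set S | [/\ bounded_ops S, positive_op S & S \o S = T]].

Definition inv_op H (T : H -> H) : H -> H :=
  xget 0 [set S | [/\ bounded_ops S, S \o T = id & T \o S = id]].

End BoundedOperators.

Section RowContractions.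
Context (R : realType) (n : nat).
Implicit Type H : hilbertType R.

Definition row_square H (X : 'I_n -> H -> H) : H -> H :=
  \sum_(i < n) (X i \o adjoint (X i)).

Definition row_norm H (X : 'I_n -> H -> H) : R :=
  Num.sqrt (opnorm (row_square X)).

Definition closed_row_ball H : set ('I_n -> H -> H) :=
  [set X | (forall i, bounded_ops (X i)) /\ row_norm X <= 1].

Definition open_row_ball H : set ('I_n -> H -> H) :=
  [set X | (forall i, bounded_ops (X i)) /\ row_norm X < 1].

(* Elements of the free semigroup on n generators are words [seq 'I_n], the
   identity g_0 being [::]. *)
Definition word_op H (X : 'I_n -> H -> H) (w : seq 'I_n) : H -> H :=
  foldr (fun i T => X i \o T) id w.

Definition defect_op H (X : 'I_n -> H -> H) : H -> H :=
  sqrt_op (id - row_square X).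

Definition scale_tuple H (r : R) (X : 'I_n -> H -> H) : 'I_n -> H -> H :=
  fun i => r%:C *: X i.

End RowContractions.

(* Noncommutative polynomials with coefficients in M_m, and the order on
   M_m(B(H)) = B(H) (x) M_m acting on the direct sum of m copies of H. *)
Section HarnackDomination.
Context (R : realType) (n : nat).
Implicit Type H : hilbertType R.

Definition nc_poly (m : nat) := {fsfun seq 'I_n -> 'M[R[i]]_m with 0}.

Definition nc_eval m H (p : nc_poly m) (X : 'I_n -> H -> H) : 'M[H -> H]_m :=
  \matrix_(i, j) \sum_(w <- finsupp p) p w i j *: word_op X w.

Definition Re_opmx m H (T : 'M[H -> H]_m) : 'M[H -> H]_m :=
  \matrix_(i, j) ((2^-1 : R[i]) *: (T i j + adjoint (T j i))).

Definition positive_opmx m H (T : 'M[H -> H]_m) :=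
  forall h : 'I_m -> H, 0 <= \sum_(i < m) \sum_(j < m) <(T i j (h j), h i)>.

Definition scale_opmx m H (c : R) (T : 'M[H -> H]_m) : 'M[H -> H]_m :=
  \matrix_(i, j) (c%:C *: T i j).

Definition harnack_dominated_by (K H : hilbertType R) (c : R)
    (A B : 'I_n -> H -> H) :=
  forall (m : nat) (p : nc_poly m),
    (forall X : 'I_n -> K -> K, open_row_ball X ->
       positive_opmx (Re_opmx (nc_eval p X))) ->
    positive_opmx (scale_opmx (c ^+ 2) (Re_opmx (nc_eval p B))
                   - Re_opmx (nc_eval p A)).

Definition harnack_dominated (K H : hilbertType R) (A B : 'I_n -> H -> H) :=
  exists2 c : R, 0 < c & harnack_dominated_by K c A B.

End HarnackDomination.

Section IsometricDilations.
Context (R : realType) (n : nat).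
Implicit Types H K : hilbertType R.

(* The inclusion of H into the dilation space K is the linear isometry [J]. *)
Record minimal_isometric_dilation H K (T : 'I_n -> H -> H)
    (J : H -> K) (V : 'I_n -> K -> K) : Prop := {
  mid_incl : bounded_ops J /\ (forall h, `|J h| = `|h|);
  mid_isom : forall i, bounded_ops (V i) /\ (forall k, `|V i k| = `|k|);
  mid_row : positive_op (id - row_square V);
  mid_adj : forall i h, adjoint (V i) (J h) = J (adjoint (T i) h);
  mid_min : total_family (fun wh : seq 'I_n * H => word_op V wh.1 (J wh.2))
}.

Definition dilation_intertwiner H (KB KA : hilbertType R) (JB : H -> KB) (W : 'I_n -> KB -> KB)
    (JA : H -> KA) (V : 'I_n -> KA -> KA) : KB -> KA :=
  xget 0 [set L | [/\ bounded_ops L, (forall h, L (JB h) = JA h)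
                    & forall i k, L (W i k) = V i (L k)]].

End IsometricDilations.

(* Hilbert space tensor products, known up to a unique unitary that respects
   the elementary tensors. *)
Record hilbert_tensor (R : realType) (H F : hilbertType R) := HilbertTensor {
  tensor_space :> hilbertType R;
  tensor : H -> F -> tensor_space;
  tensor_linearl : forall f, linear (tensor^~ f);
  tensor_linearr : forall h, linear (tensor h);
  tensor_inner : forall h h' f f',
    <(tensor h f, tensor h' f')> = <(h, h')> * <(f, f')>;
  tensor_total : total_family (fun hf : H * F => tensor hf.1 hf.2)
}.

Definition tensor_op (R : realType) (H F : hilbertType R)
    (HF : hilbert_tensor H F) (S : H -> H) (T : F -> F) : HF -> HF :=
  xget 0 [set U | bounded_ops U /\
                  forall h f, U (tensor HF h f) = tensor HF (S h) (T f)].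
Arguments tensor_op {R H F} HF S T.

(* The full Fock space of an n-dimensional space with orthonormal basis
   e_1, ..., e_n: [fock_basis [:: i1; ...; ik]] is e_i1 (x) ... (x) e_ik, so
   words of length k span the k-th tensor power and [::] gives the vacuum. *)
Record fock_space (R : realType) (n : nat) := FockSpace {
  fock_carrier :> hilbertType R;
  fock_basis : seq 'I_n -> fock_carrier;
  fock_orthonormal : forall v w,
    <(fock_basis v, fock_basis w)> = (v == w)%:R;
  fock_total : total_family fock_basis
}.

Section ReconstructionOperator.
Context (R : realType) (n : nat) (H : hilbertType R) (F : fock_space R n)
        (HF : hilbert_tensor H F).

(* Right creation operators, phi |-> phi (x) e_i. *)
Definition right_creation (i : 'I_n) : F -> F :=
  xget 0 [set U | bounded_ops U /\
                  forall w, U (fock_basis F w) = fock_basis F (rcons w i)].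

Definition reconstruction_op (X : 'I_n -> H -> H) : HF -> HF :=
  \sum_(i < n) tensor_op HF (adjoint (X i)) (right_creation i).

Definition C_op (X : 'I_n -> H -> H) : HF -> HF :=
  tensor_op HF (defect_op X) id \o inv_op (id - reconstruction_op X).

End ReconstructionOperator.

Arguments C_op {R n H F} HF X.

(* Main.v *)
(* Let Q_X be the Poisson form of X, the quadratic form on finite families (h_w)
   of vectors of H indexed by words with Q_X(h) = |\sum_w V_w h_w|^2 for the
   minimal isometric dilation V of X.  Its Gram matrix is a Toeplitz matrix in the
   X_g, so that Q_X makes sense without V.  As L_{B,A} maps \sum_w W_w h_w to
   \sum_w V_w h_w, one has |L_{B,A}| <= c iff Q_A <= c^2 Q_B.

   If X is a strict row contraction, h = \sum_w h_w (x) e_w and g = (I - R_X)^-1 h,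
   then R_X^* R_X + (Delta_X (x) I)^2 = I gives
     |C_X h|^2 = |g|^2 - |R_X g|^2 = |g|^2 - |g - h|^2 = 2 Re <g, h> - |h|^2 = Q_X(h),
   hence also |C_A C_B^-1| <= c iff Q_A <= c^2 Q_B.

   On the boundary, each finite Toeplitz matrix of X is 2 Re p(X) for a matrix
   polynomial p, and it is positive on the open ball; so Harnack domination gives
   Q_A <= c^2 Q_B for some c.  Replacing X by rX multiplies the Toeplitz matrix
   entrywise by the positive kernel r^||v| - |w||, so Q_A <= c^2 Q_B implies
   Q_rA <= c^2 Q_rB; the converse is the limit r -> 1. *)
Require Import Defs.
From HB Require Import structures.
From mathcomp Require Import all_boot all_order all_algebra.
From mathcomp Require Import sesquilinear finmap complex.
From mathcomp Require Import all_classical all_reals all_analysis.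
From mathcomp Require Import ring lra.

Set Implicit Arguments.
Unset Strict Implicit.
Unset Printing Implicit Defensive.

Import Order.TTheory GRing.Theory Num.Theory.
Import numFieldNormedType.Exports.

Local Open Scope classical_set_scope.
Local Open Scope ring_scope.
Local Open Scope complex_scope.

(** * Norms and inner products *)

(** Every operator of the statement (adjoint, square root, inverse, tensor product, creation
    operator, intertwiner) is [xget 0 P], so nothing is known of it until a witness of [P] is
    exhibited. This shapes the first half: a witness is either a limit of a sequence with
    geometrically decreasing steps, or the extension of a bounded map given on a total family. For
    the same reason some finite c with Q_A <= c^2 Q_B must be found before L_{B,A} can be discussed:
    in the open ball it is the norm of C_A C_B^-1, on the boundary Harnack domination supplies it.

    Two recursions on words carry the algebra. Positivity of Q_X peels off first letters, where the
    isometries of a dilation act. The identity 2 Re <g, h> - |h|^2 = Q_X(h) peels off last letters,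
    where R_X acts: its adjoint strips the last letter i and applies X_i, which is also how the
    Toeplitz entries evolve.

    The kernel r^||v| - |w|| sees only lengths, so its positivity is that of the scalar kernel r^|i
    - j|, obtained from an explicit sum of rank-one kernels with telescoping weights. *)

Section Basics.
Context (R : realType).
Implicit Types H K : hilbertType R.

(** Norms and inner products live in [R[i]]; these real versions make the total order and real
    arithmetic available. *)
Definition hnorm H (x : H) : R := complex.Re `|x|.
Definition rinner H (x y : H) : R := complex.Re <(x, y)>.

Lemma hnormE H (x : H) : `|x| = (hnorm x)%:C.
Proof. by rewrite /hnorm RRe_real // ger0_real. Qed.

Lemma hnorm_ge0 H (x : H) : 0 <= hnorm x.
Proof. rewrite -lecR -hnormE; exact: normr_ge0. Qed.

Lemma hnorm0 H : hnorm (0 : H) = 0.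
Proof. by rewrite /hnorm normr0. Qed.

Lemma hnorm_eq0 H (x : H) : hnorm x = 0 -> x = 0.
Proof. by move=> h; apply/normr0_eq0; rewrite hnormE h. Qed.

Lemma ler_hnormD H (x y : H) : hnorm (x + y) <= hnorm x + hnorm y.
Proof. by rewrite -lecR rmorphD /= -!hnormE ler_normD. Qed.

Lemma hnorm_opp H (x : H) : hnorm (- x) = hnorm x.
Proof. by rewrite /hnorm normrN. Qed.

Lemma hnormBC H (x y : H) : hnorm (x - y) = hnorm (y - x).
Proof. by rewrite -opprB hnorm_opp. Qed.

Lemma hnorm_triangle H (x y z : H) : hnorm (x - z) <= hnorm (x - y) + hnorm (y - z).
Proof. by rewrite (_ : x - z = (x - y) + (y - z)) ?ler_hnormD // addrA subrK. Qed.

Lemma hnormZ H (a : R) (x : H) : hnorm (a%:C *: x) = `|a| * hnorm x.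
Proof.
apply: (@complexI R); rewrite -hnormE normrZ hnormE rmorphM /=; congr (_ * _).
by rewrite normc_def /= expr0n addr0 sqrtr_sqr.
Qed.

Lemma hnormZC H (a : R[i]) (x : H) : hnorm (a *: x) = complex.Re `|a| * hnorm x.
Proof.
apply: (@complexI R); rewrite -hnormE normrZ hnormE rmorphM /=; congr (_ * _).
Qed.

Lemma innerC H (x y : H) : <(y, x)> = <(x, y)>^*.
Proof. by rewrite hermC /= expr0 mul1r. Qed.

Lemma innerDl H (x y z : H) : <(x + y, z)> = <(x, z)> + <(y, z)>.
Proof. by rewrite linearDl. Qed.

Lemma innerDr H (x y z : H) : <(z, x + y)> = <(z, x)> + <(z, y)>.
Proof. by rewrite linearDr. Qed.

Lemma innerNl H (x z : H) : <(- x, z)> = - <(x, z)>.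
Proof. by rewrite linearNl. Qed.

Lemma innerNr H (x z : H) : <(z, - x)> = - <(z, x)>.
Proof. by rewrite linearNr. Qed.

Lemma innerZl H a (x z : H) : <(a *: x, z)> = a * <(x, z)>.
Proof. by rewrite linearZl_LR. Qed.

Lemma innerZr H a (x z : H) : <(z, a *: x)> = (a^*)%C * <(z, x)>.
Proof. by rewrite linearZr_LR. Qed.

Lemma inner0l H (x : H) : <(0, x)> = 0.
Proof. by rewrite linear0l. Qed.

Lemma inner0r H (x : H) : <(x, 0)> = 0.
Proof. by rewrite linear0r. Qed.

Lemma inner_suml H I (r : seq I) (P : pred I) (f : I -> H) y :
  <(\sum_(i <- r | P i) f i, y)> = \sum_(i <- r | P i) <(f i, y)>.
Proof. by rewrite linear_sumlz. Qed.

Lemma inner_sumr H I (r : seq I) (P : pred I) (f : I -> H) y :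
  <(y, \sum_(i <- r | P i) f i)> = \sum_(i <- r | P i) <(y, f i)>.
Proof. by rewrite linear_sumr. Qed.

Lemma inner_xx H (x : H) : <(x, x)> = (hnorm x ^+ 2)%:C.
Proof. by rewrite inner_norm hnormE rmorphXn. Qed.

Lemma hnorm_sqr H (x : H) : hnorm x ^+ 2 = rinner x x.
Proof. by rewrite /rinner inner_xx. Qed.

Lemma rinnerC H (x y : H) : rinner x y = rinner y x.
Proof. by rewrite /rinner innerC; case: <(y, x)>. Qed.

Lemma rinnerDl H (x y z : H) : rinner (x + y) z = rinner x z + rinner y z.
Proof. by rewrite /rinner innerDl raddfD. Qed.

Lemma rinnerDr H (x y z : H) : rinner z (x + y) = rinner z x + rinner z y.
Proof. by rewrite /rinner innerDr raddfD. Qed.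

Lemma rinnerNl H (x z : H) : rinner (- x) z = - rinner x z.
Proof. by rewrite /rinner innerNl raddfN. Qed.

Lemma rinnerNr H (x z : H) : rinner z (- x) = - rinner z x.
Proof. by rewrite /rinner innerNr raddfN. Qed.

Lemma rinnerZl H (a : R) (x z : H) : rinner (a%:C *: x) z = a * rinner x z.
Proof. by rewrite /rinner innerZl; case: <(x,z)> => u v /=; rewrite mul0r subr0. Qed.

Lemma rinnerZr H (a : R) (x z : H) : rinner z (a%:C *: x) = a * rinner z x.
Proof. by rewrite rinnerC rinnerZl rinnerC. Qed.

Lemma rinner_suml H I (r : seq I) (P : pred I) (f : I -> H) y :
  rinner (\sum_(i <- r | P i) f i) y = \sum_(i <- r | P i) rinner (f i) y.
Proof. by rewrite /rinner inner_suml raddf_sum. Qed.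

Lemma rinner_sumr H I (r : seq I) (P : pred I) (f : I -> H) y :
  rinner y (\sum_(i <- r | P i) f i) = \sum_(i <- r | P i) rinner y (f i).
Proof. by rewrite /rinner inner_sumr raddf_sum. Qed.

Lemma hnormD_sqr H (x y : H) :
  hnorm (x + y) ^+ 2 = hnorm x ^+ 2 + 2 * rinner x y + hnorm y ^+ 2.
Proof. by rewrite !hnorm_sqr !rinnerDl !rinnerDr (rinnerC y x); ring. Qed.

Lemma hnormB_sqr H (x y : H) :
  hnorm (x - y) ^+ 2 = hnorm x ^+ 2 - 2 * rinner x y + hnorm y ^+ 2.
Proof. by rewrite hnormD_sqr hnorm_opp rinnerNr; ring. Qed.

(** Cauchy-Schwarz: expand the square of the norm of |y| x - |x| y and divide by 2 |x| |y|, the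
    degenerate cases being treated apart. *)
Lemma rinner_le H (x y : H) : rinner x y <= hnorm x * hnorm y.
Proof.
have hx := hnorm_ge0 x; have hy := hnorm_ge0 y.
have [y0|ny0] := eqVneq (hnorm y) 0.
  by rewrite (hnorm_eq0 y0) /rinner inner0r hnorm0 mulr0.
have [x0|nx0] := eqVneq (hnorm x) 0.
  by rewrite (hnorm_eq0 x0) /rinner inner0l hnorm0 mul0r.
have px : 0 < hnorm x by rewrite lt_def nx0.
have py : 0 < hnorm y by rewrite lt_def ny0.
have := sqr_ge0 (hnorm ((hnorm y)%:C *: x - (hnorm x)%:C *: y)).
rewrite hnormB_sqr !hnormZ !ger0_norm // rinnerZl rinnerZr => h.
have : 0 <= (2 * hnorm x * hnorm y) * (hnorm x * hnorm y - rinner x y) by nra.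
by rewrite pmulr_rge0 ?subr_ge0 // !mulr_gt0.
Qed.

(** Upgrades identities between real parts to identities between inner products, for maps that
    commute with multiplication by i. *)
Lemma innerE H (x y : H) : <(x, y)> = rinner x y +i* rinner x ('i *: y).
Proof. by rewrite /rinner innerZr; case: <(x,y)> => a b /=; congr (_ +i* _); ring. Qed.

Lemma inner_ext H (x y : H) : (forall z, <(x, z)> = <(y, z)>) -> x = y.
Proof.
move=> e; apply/eqP; rewrite -subr_eq0; apply/eqP/hnorm_eq0.
by apply/eqP; rewrite -sqrf_eq0 hnorm_sqr /rinner innerDl innerNl e subrr.
Qed.

Lemma hnorm_le_dual H (x : H) (c : R) : 0 <= c ->
  (forall z, rinner x z <= c * hnorm z) -> hnorm x <= c.
Proof.
move=> c0 /(_ x); rewrite -hnorm_sqr expr2 => h.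
have [->//|n0] := eqVneq (hnorm x) 0.
by move: h; rewrite ler_pM2r // lt_def n0 hnorm_ge0.
Qed.

Lemma le_of_sqr (a b : R) : 0 <= b -> a ^+ 2 <= b ^+ 2 -> a <= b.
Proof. by move=> b0 h; rewrite leNgt; apply/negP => ba; nra. Qed.

(** Passage to the limit without limits: approximations come with errors C q^k, and this lemma turns
    them into exact relations. *)
Lemma geometric_le0 (a C q : R) :
  0 <= q < 1 -> (forall k, a <= C * q ^+ k) -> a <= 0.
Proof.
move=> /andP[q0 q1] h.
have cv : (fun k => C * q ^+ k) @ \oo --> C * 0.
  by apply: cvgMl_tmp; apply: cvg_expr; rewrite ger0_norm.
by rewrite -(mulr0 C); apply: (cvgr_to_ge cv); exact: nearW.
Qed.

End Basics.

(** * Bounded operators *)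

Section Operators.
Context (R : realType).
Implicit Types H K : hilbertType R.

Definition hbounded H K (T : H -> K) (c : R) := forall x, hnorm (T x) <= c * hnorm x.

Section Linear.
Variables (H K : hilbertType R) (T : H -> K).
Hypothesis linT : linear T.

Lemma lin0 : T 0 = 0.
Proof. by have := linT (-1) 0 0; rewrite scaleN1r oppr0 addr0 scaleN1r addNr. Qed.

Lemma linD x y : T (x + y) = T x + T y.
Proof. by rewrite -[x]scale1r linT !scale1r. Qed.

Lemma linZ a x : T (a *: x) = a *: T x.
Proof. by rewrite -[a *: x]addr0 linT lin0 addr0. Qed.

Lemma linN x : T (- x) = - T x.
Proof. by rewrite -scaleN1r linZ scaleN1r. Qed.

Lemma linB x y : T (x - y) = T x - T y.
Proof. by rewrite linD linN. Qed.

Lemma lin_sum I (r : seq I) (P : pred I) (f : I -> H) :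
  T (\sum_(i <- r | P i) f i) = \sum_(i <- r | P i) T (f i).
Proof. by elim/big_rec2: _ => [|i x y _ <-]; rewrite ?lin0 ?linD. Qed.

End Linear.

Lemma bounded_opsI H K (T : H -> K) (c : R) :
  linear T -> hbounded T c -> bounded_ops T.
Proof.
move=> linT bT; split=> // x.
apply/cvgrPdist_lt => e e0.
have eE : e = (complex.Re e)%:C by rewrite RRe_real // gtr0_real.
have re0 : 0 < complex.Re e by rewrite -ltcR -eE.
have c1 : 0 < `|c| + 1 by rewrite ltr_pwDr.
have d0 : 0 < (complex.Re e / (`|c| + 1))%:C by rewrite ltcR divr_gt0.
near=> y.
have : `|x - y| < (complex.Re e / (`|c| + 1))%:C by near: y; apply: cvgr_dist_lt.
rewrite -linB // !hnormE eE !ltcR ltr_pdivlMr // => h.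
apply: le_lt_trans (bT _) _; apply: le_lt_trans h.
rewrite mulrC ler_wpM2l ?hnorm_ge0 //.
by rewrite (le_trans (ler_norm c)) // lerDl.
Unshelve. all: by end_near. Qed.

Lemma bounded_opsE H K (T : H -> K) : bounded_ops T ->
  linear T /\ exists2 c, 0 <= c & hbounded T c.
Proof.
move=> [linT cT]; split=> //.
pose mT := GRing.isLinear.Build _ _ _ _ T linT.
pose T' : {linear H -> K} := HB.pack T mT.
have /linear_boundedP[M [Mr hM]] := @continuous_linear_bounded _ _ _ 0 T' (cT 0).
(* Every real number beyond M is a bound, and |M| + 1 is such a number that is also nonnegative. *)
exists (complex.Re (`|M| + 1)).
  by rewrite -ler0c RRe_real ?ger0_real // addr_ge0.
have ME : `|M| + 1 = (complex.Re (`|M| + 1))%:C.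
  by rewrite RRe_real // ger0_real // addr_ge0.
move=> x; rewrite -lecR rmorphM /= -ME -!hnormE; apply: hM.
by rewrite (le_lt_trans (real_ler_norm Mr)) // ltrDl.
Qed.

(** The only place where completeness of H enters. The steps from k on sum to at most C q^k / (1 -
    q); keeping this rate lets later proofs finish with [geometric_le0]. *)
Lemma complete_geometric H (u : nat -> H) (C q : R) : 0 <= q < 1 ->
  (forall k, hnorm (u k.+1 - u k) <= C * q ^+ k) ->
  exists x, forall k, hnorm (x - u k) <= C / (1 - q) * q ^+ k.
Proof.
move=> /andP[q0 q1] hu.
have p0 : 0 < 1 - q by rewrite subr_gt0.
have C0 : 0 <= C by have := le_trans (hnorm_ge0 _) (hu 0); rewrite expr0 mulr1.
pose D := C / (1 - q).
have D0 : 0 <= D by rewrite divr_ge0 // ltW.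
have DE : C = D * (1 - q) by rewrite /D divfK // gt_eqF.
have step k m : hnorm (u (k + m)%N - u k) <= D * (q ^+ k - q ^+ (k + m)).
  elim: m => [|m IH]; first by rewrite addn0 !subrr hnorm0 mulr0.
  rewrite addnS; apply: le_trans (hnorm_triangle _ (u (k + m)%N) _) _.
  apply: le_trans (lerD (hu _) IH) _.
  by rewrite DE exprS le_eqVlt; apply/orP; left; apply/eqP; ring.
have bnd k m : hnorm (u (k + m)%N - u k) <= D * q ^+ k.
  apply: le_trans (step _ _) _; rewrite ler_wpM2l //.
  by rewrite lerBlDr lerDl exprn_ge0.
have cvq : (fun k => D * q ^+ k) @ \oo --> (0 : R).
  by rewrite -[X in _ --> X](mulr0 D); apply: cvgMl_tmp; apply: cvg_expr; rewrite ger0_norm.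
have cu : cvg (u @ \oo).
  apply/cauchy_cvgP/cauchyP => e e0.
  have eE : e = (complex.Re e)%:C by rewrite RRe_real // gtr0_real.
  have re0 : 0 < complex.Re e by rewrite -ltcR -eE.
  have /cvgrPdist_lt/(_ _ re0)[N _ hN] := cvq.
  exists (u N); exists N => // m /= Nm; rewrite -ball_normE /= hnormE eE ltcR.
  rewrite hnormBC -(subnKC Nm) (le_lt_trans (bnd _ _)) //.
  by have := hN N (leqnn N); rewrite /= sub0r normrN ger0_norm // mulr_ge0 // exprn_ge0.
exists (lim (u @ \oo)) => k; apply/ler_addgt0Pr => e e0.
have eC : 0 < e%:C by rewrite ltcR.
have /cvgrPdist_lt/(_ _ eC)[N _ hN] : u @ \oo --> lim (u @ \oo) by [].
have := hN (k + N)%N (leq_addl _ _); rewrite /= hnormE ltcR => /ltW h.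
rewrite [_ + e]addrC; apply: le_trans (hnorm_triangle _ (u (k + N)%N) _) _.
exact: lerD h (bnd _ _).
Qed.

End Operators.

Section OperatorAlgebra.
Context (R : realType).
Implicit Types H K : hilbertType R.

Lemma bounded_ops_lin H K (T : H -> K) : bounded_ops T -> linear T.
Proof. by case. Qed.

Lemma bounded_ops_id H : bounded_ops (id : H -> H).
Proof. by apply: (@bounded_opsI _ _ _ _ 1) => // x; rewrite mul1r. Qed.

Lemma bounded_ops0 H K : bounded_ops (0 : H -> K).
Proof.
apply: (@bounded_opsI _ _ _ _ 0) => [a x y|x]; first by rewrite /= scaler0 addr0.
by rewrite /= hnorm0 mul0r.
Qed.

Lemma bounded_opsD H K (S T : H -> K) :
  bounded_ops S -> bounded_ops T -> bounded_ops (S + T).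
Proof.
move=> /bounded_opsE[lS [c c0 bS]] /bounded_opsE[lT [d d0 bT]].
apply: (@bounded_opsI _ _ _ _ (c + d)) => [a x y|x].
  by rewrite !fctE lS lT scalerDr !addrA; congr (_ + _); rewrite -!addrA [S y + _]addrC.
by rewrite fctE (le_trans (ler_hnormD _ _)) // mulrDl lerD.
Qed.

Lemma bounded_opsZ H K a (T : H -> K) : bounded_ops T -> bounded_ops (a *: T).
Proof.
move=> /bounded_opsE[lT [d d0 bT]].
apply: (@bounded_opsI _ _ _ _ (complex.Re `|a| * d)) => [b x y|x].
  by rewrite !fctE lT scalerDr !scalerA mulrC.
rewrite fctE hnormZC -mulrA ler_wpM2l //.
by rewrite -ler0c RRe_real ?ger0_real.
Qed.

Lemma bounded_opsN H K (T : H -> K) : bounded_ops T -> bounded_ops (- T).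
Proof. by rewrite -scaleN1r; apply: bounded_opsZ. Qed.

Lemma bounded_opsB H K (S T : H -> K) :
  bounded_ops S -> bounded_ops T -> bounded_ops (S - T).
Proof. by move=> bS bT; apply: bounded_opsD => //; apply: bounded_opsN. Qed.

Lemma bounded_ops_sum H K I (r : seq I) (P : pred I) (T : I -> H -> K) :
  (forall i, P i -> bounded_ops (T i)) -> bounded_ops (\sum_(i <- r | P i) T i).
Proof. by move=> h; elim/big_rec: _ => [|i S Pi bS]; [exact: bounded_ops0|apply: bounded_opsD; auto]. Qed.

Lemma bounded_ops_comp H K (L' : hilbertType R) (S : K -> L') (T : H -> K) :
  bounded_ops S -> bounded_ops T -> bounded_ops (S \o T).
Proof.
move=> /bounded_opsE[lS [c c0 bS]] /bounded_opsE[lT [d d0 bT]].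
apply: (@bounded_opsI _ _ _ _ (c * d)) => [a x y|x].
  by rewrite /= lT lS.
by rewrite /= (le_trans (bS _)) // -mulrA ler_wpM2l.
Qed.

Lemma sum_fctE H K I (r : seq I) (P : pred I) (T : I -> H -> K) x :
  (\sum_(i <- r | P i) T i) x = \sum_(i <- r | P i) T i x.
Proof. by elim/big_rec2: _ => // i y S _ <-. Qed.

End OperatorAlgebra.

(** * Total families and density arguments *)

Section Total.
Context (R : realType).
Implicit Types H K : hilbertType R.

(** Coefficients are stored with their indices, unlike in [total_family]: combinations are then
    added by concatenation even when an index repeats with different coefficients. *)
Definition lincomb H (I : Type) (v : I -> H) (l : seq (R[i] * I)) : H :=
  \sum_(p <- l) p.1 *: v p.2.

Lemma lin_lincomb H K (T : H -> K) I (v : I -> H) l : linear T ->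
  T (lincomb v l) = lincomb (T \o v) l.
Proof.
by move=> lT; rewrite lin_sum //; apply: eq_bigr => p _; rewrite linZ.
Qed.

Lemma lincombP H I (v : I -> H) l l' a :
  lincomb v ([seq (a * p.1, p.2) | p <- l] ++ l') = a *: lincomb v l + lincomb v l'.
Proof.
rewrite /lincomb big_cat big_map scaler_sumr; congr (_ + _).
by apply: eq_bigr => p _; rewrite scalerA.
Qed.

Lemma total_approx H I (v : I -> H) : total_family v ->
  forall x e, 0 < e -> exists l, hnorm (x - lincomb v l) < e.
Proof.
move=> tv x e e0; have : [set: H] x by [].
rewrite -tv => /(_ (ball x e%:C)) []; first by apply: nbhsx_ballx; rewrite ltcR.
move=> _ [[s [c ->]]]; rewrite -ball_normE /= hnormE ltcR => h.
by exists [seq (c k, k) | k <- s]; rewrite /lincomb big_map.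
Qed.

Lemma approx_total H I (v : I -> H) :
  (forall x e, 0 < e -> exists2 l, hnorm (x - lincomb v l) < e
    & exists (s : seq I) (c : I -> R[i]), lincomb v l = \sum_(k <- s) c k *: v k) ->
  total_family v.
Proof.
move=> h; rewrite /total_family eqEsubset; split=> // x _ B.
rewrite -nbhs_ballE => -[e /= e0 be].
have eE : e = (complex.Re e)%:C by rewrite RRe_real // gtr0_real.
have [|l hl sc] := h x (complex.Re e); first by rewrite -ltcR -eE.
exists (lincomb v l); split => //; apply: be.
by rewrite -ball_normE /= hnormE eE ltcR.
Qed.

Lemma total_eq H K I (v : I -> H) (S T : H -> K) : total_family v ->
  bounded_ops S -> bounded_ops T -> (forall i, S (v i) = T (v i)) -> S = T.
Proof.
move=> tv bS bT e; apply/funext => x.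
have /bounded_opsE[lD [c c0 bD]] := bounded_opsB bS bT.
apply/eqP; rewrite -subr_eq0; apply/eqP/hnorm_eq0/le_anti; rewrite hnorm_ge0 andbT.
apply/ler_addgt0Pr => d d0; rewrite add0r.
have c1 : 0 < c + 1 by rewrite ltr_pwDr.
have [|l hl] := total_approx tv x (e := d / (c + 1)); first by rewrite divr_gt0.
have z : (S - T) (lincomb v l) = 0.
  rewrite lin_lincomb // /lincomb big1 // => p _.
  by rewrite !fctE /= e subrr scaler0.
have -> : S x - T x = (S - T) (x - lincomb v l) by rewrite linB // z subr0.
apply: le_trans (bD _) _; rewrite ltr_pdivlMr // in hl.
apply: le_trans (ltW hl); rewrite mulrC ler_wpM2l ?hnorm_ge0 //.
by rewrite lerDl.
Qed.

Lemma total_inner H I (v : I -> H) x y : total_family v ->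
  (forall i, <(x, v i)> = <(y, v i)>) -> x = y.
Proof.
move=> tv e; apply/eqP; rewrite -subr_eq0; apply/eqP; set z := x - y.
have zv i : <(z, v i)> = 0 by rewrite innerDl innerNl e subrr.
apply/hnorm_eq0/le_anti; rewrite hnorm_ge0 andbT.
apply/ler_addgt0Pr => d d0; rewrite add0r.
have [l hl] := total_approx tv z d0.
have zl : rinner z (lincomb v l) = 0.
  by rewrite /rinner inner_sumr big1 // => p _; rewrite innerZr zv mulr0.
have h : hnorm z ^+ 2 <= hnorm z * d.
  rewrite hnorm_sqr -[X in X <= _](subr0 _) -zl -rinnerNr -rinnerDr.
  by rewrite (le_trans (rinner_le _ _)) // ler_wpM2l ?hnorm_ge0 // ltW.
have [->|n0] := eqVneq (hnorm z) 0; first exact: ltW.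
by move: h; rewrite expr2 ler_pM2l // lt_def n0 hnorm_ge0.
Qed.

(** Comparing with a second operator [T] serves two ends: [T := id] bounds the intertwiner,
    [T := C_op HF B] bounds the quotient of the [C_op]. *)
Lemma hbounded_total H K K' I (v : I -> H) (S : H -> K) (T : H -> K') (c : R) :
  total_family v -> bounded_ops S -> bounded_ops T -> 0 <= c ->
  (forall l, hnorm (S (lincomb v l)) <= c * hnorm (T (lincomb v l))) ->
  forall x, hnorm (S x) <= c * hnorm (T x).
Proof.
move=> tv /bounded_opsE[lS [s s0 bS]] /bounded_opsE[lT [t t0 bT]] c0 h x.
apply/ler_addgt0Pr => d d0.
(* Replacing x by a combination at distance t' costs s t' on the left and c t t' on the right; the 1
   keeps the divisor positive. *)
have p0 : 0 < s + c * t + 1 by rewrite ltr_pwDr // addr_ge0 // mulr_ge0.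
have [|l hl] := total_approx tv x (e := d / (s + c * t + 1)); first by rewrite divr_gt0.
set y := lincomb v l in hl.
have hS : hnorm (S x) <= hnorm (S y) + s * hnorm (x - y).
  have -> : S x = S y + S (x - y) by rewrite -linD // addrC subrK.
  by rewrite (le_trans (ler_hnormD _ _)) // lerD2l.
have hT : hnorm (T y) <= hnorm (T x) + t * hnorm (x - y).
  have -> : T y = T x + T (y - x) by rewrite -linD // addrC subrK.
  by rewrite (le_trans (ler_hnormD _ _)) // lerD2l hnormBC.
apply: le_trans hS _; apply: le_trans (lerD (h l) (lexx _)) _.
apply: le_trans (lerD (ler_wpM2l c0 hT) (lexx _)) _.
rewrite mulrDr -addrA lerD2l mulrA -mulrDl addrC.
rewrite ltr_pdivlMr // in hl.
apply: le_trans (ltW hl); rewrite mulrC ler_wpM2l ?hnorm_ge0 //.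
by rewrite addrC lerDl.
Qed.

End Total.

(** * Extension by density and Riesz representation *)

Section Existence.
Context (R : realType).
Implicit Types H K : hilbertType R.

Lemma half_itv : 0 <= (2^-1 : R) < 1.
Proof. by rewrite invr_ge0 ler0n /= invf_lt1 // ltr1n. Qed.

(* The extension is the closure of the graph of [v i |-> u i]; the bound makes
   it single-valued. *)
Lemma bounded_extension H K I (v : I -> H) (u : I -> K) (c : R) :
  total_family v -> 0 <= c ->
  (forall l, hnorm (lincomb u l) <= c * hnorm (lincomb v l)) ->
  exists T : H -> K, [/\ linear T, hbounded T c & forall i, T (v i) = u i].
Proof.
move=> tv c0 h.
pose P x y := forall e, 0 < e ->
  exists l, hnorm (x - lincomb v l) < e /\ hnorm (y - lincomb u l) < e.
have P_lin a x y x' y' : P x y -> P x' y' -> P (a *: x + x') (a *: y + y').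
  move=> hx hx' e e0.
  pose m := complex.Re `|a| + 1.
  have a0 : 0 <= complex.Re `|a| by rewrite -ler0c RRe_real ?ger0_real.
  have m0 : 0 < m by rewrite ltr_pwDr.
  have [|l [l1 l2]] := hx (e / 2 / m); first by rewrite !divr_gt0.
  have [|l' [l'1 l'2]] := hx' (e / 2); first by rewrite divr_gt0.
  exists ([seq (a * p.1, p.2) | p <- l] ++ l').
  have est (L : hilbertType R) (z w z' w' : L) :
      hnorm (z - w) < e / 2 / m -> hnorm (z' - w') < e / 2 ->
      hnorm (a *: z + z' - (a *: w + w')) < e.
    move=> h1 h2; rewrite opprD addrACA -scalerBr (splitr e).
    apply: le_lt_trans (ler_hnormD _ _) _; apply: ler_ltD => //.
    rewrite ltr_pdivlMr // in h1; rewrite hnormZC; apply: le_trans (ltW h1).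
    by rewrite mulrC ler_wpM2l ?hnorm_ge0 // lerDl.
  by rewrite !lincombP; split; apply: est.
have P_bnd x y : P x y -> hnorm y <= c * hnorm x.
  move=> hx; apply/ler_addgt0Pr => d d0.
  have c1 : 0 < c + 1 by rewrite ltr_pwDr.
  have [|l [l1 l2]] := hx (d / (c + 1)); first by rewrite divr_gt0.
  have hy : hnorm y <= hnorm (y - lincomb u l) + hnorm (lincomb u l).
    by rewrite -[X in hnorm X <= _](subrK (lincomb u l)) ler_hnormD.
  have hv : hnorm (lincomb v l) <= hnorm (x - lincomb v l) + hnorm x.
    by rewrite hnormBC -[X in hnorm X <= _](subrK x) ler_hnormD.
  apply: le_trans hy _; apply: le_trans (lerD (lexx _) (h l)) _.
  apply: le_trans (lerD (ltW l2) (ler_wpM2l c0 hv)) _.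
  apply: le_trans (lerD (lexx _) (ler_wpM2l c0 (lerD (ltW l1) (lexx _)))) _.
  have : d / (c + 1) * (c + 1) = d by rewrite divfK // gt_eqF.
  by move: (d / (c + 1)) => t; lra.
have P_ex x : exists y, P x y.
  pose q : R := 2^-1.
  have q0 : 0 < q by rewrite invr_gt0.
  have /choice[l hl] : forall k, exists l, hnorm (x - lincomb v l) < q ^+ k.
    by move=> k; apply: total_approx => //; rewrite exprn_gt0.
  (* Consecutive approximations of x differ by at most q^(k+1) + q^k <= 2 q^k, hence their images by
     2 c q^k. *)
  have [k|y hy] := complete_geometric (u := fun k => lincomb u (l k)) (C := c * 2) half_itv.
    have dE (J : Type) (L : hilbertType R) (f : J -> L) a b :
        lincomb f a - lincomb f b = lincomb f ([seq (- 1 * p.1, p.2) | p <- b] ++ a).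
      by rewrite lincombP scaleN1r addrC.
    rewrite dE; apply: le_trans (h _) _; rewrite -dE -mulrA ler_wpM2l //.
    rewrite (le_trans (hnorm_triangle _ x _)) // hnormBC.
    apply: le_trans (lerD (ltW (hl _)) (ltW (hl _))) _.
    have := exprn_gt0 k q0; have := half_itv; rewrite -/q exprS => /andP[_ /ltW q1 qk].
    have : q * q ^+ k <= 1 * q ^+ k by rewrite ler_wpM2r // ltW.
    by lra.
  exists y => e e0.
  set D := c * 2 / (1 - 2^-1) in hy.
  have D0 : 0 <= D by rewrite divr_ge0 ?mulr_ge0 // subr_ge0 ltW; case/andP: half_itv.
  have D1 : 0 < D + 1 by rewrite ltr_pwDr.
  have [k hk] : exists k, q ^+ k < e / (D + 1).
    have cv : (fun k => q ^+ k) @ \oo --> (0 : R).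
      by apply: cvg_expr; rewrite ger0_norm ?(ltW q0) //; case/andP: half_itv.
    have /cvgrPdist_lt/(_ (e / (D + 1))) [|N _ hN] := cv; first by rewrite divr_gt0.
    exists N; have := hN N (leqnn N); rewrite /= sub0r normrN ger0_norm //.
    by rewrite exprn_ge0 // ltW.
  have eq : (D + 1) * q ^+ k < e by rewrite mulrC -ltr_pdivlMr.
  have qk : 0 < q ^+ k by rewrite exprn_gt0.
  have Dqk : 0 <= D * q ^+ k by rewrite mulr_ge0 // ltW.
  rewrite mulrDl mul1r in eq.
  exists (l k); split; first by apply: lt_trans (hl k) _; apply: le_lt_trans eq; rewrite lerDr.
  by apply: le_lt_trans (hy k) _; apply: le_lt_trans eq; rewrite lerDl ltW.
have [T hT] := choice P_ex.
have uniq x y : P x y -> y = T x.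
  move=> hy; have := P_bnd _ _ (P_lin (-1) _ _ _ _ hy (hT x)).
  rewrite !scaleN1r addNr hnorm0 mulr0 => h0.
  have /hnorm_eq0/eqP : hnorm (- y + T x) = 0 by apply/le_anti; rewrite h0 hnorm_ge0.
  by rewrite addrC subr_eq0 => /eqP.
exists T; split=> [a x y|x|i]; first by apply/esym/uniq/P_lin.
  exact: P_bnd.
apply/esym/uniq => e e0; exists [:: (1, i)].
by rewrite /lincomb !big_seq1 !scale1r !subrr !hnorm0.
Qed.

(* The representing vector minimises [|x| ^ 2 - 2 Re (phi x)]; minimising
   sequences are Cauchy by the parallelogram law. *)
Lemma riesz H (phi : H -> R[i]) (c : R) : 0 <= c ->
  (forall a x y, phi (a *: x + y) = a * phi x + phi y) ->
  (forall x, complex.Re (phi x) <= c * hnorm x) ->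
  exists z, forall x, phi x = <(x, z)>.
Proof.
move=> c0 lphi bphi.
pose f x := complex.Re (phi x).
have phi0 : phi 0 = 0.
  by have := lphi (-1) 0 0; rewrite scaleN1r oppr0 addr0 mulN1r addNr.
have phiD x y : phi (x + y) = phi x + phi y by rewrite -[x]scale1r lphi mul1r scale1r.
have phiZ a x : phi (a *: x) = a * phi x by rewrite -[a *: x]addr0 lphi phi0 addr0.
have fD x y : f (x + y) = f x + f y by rewrite /f phiD raddfD.
have fZ (a : R) x : f (a%:C *: x) = a * f x.
  by rewrite /f phiZ; case: (phi x) => u v /=; rewrite mul0r subr0.
have fN x : f (- x) = - f x by rewrite -scaleN1r (_ : -1 = (-1)%:C) ?fZ ?mulN1r // rmorphN1.
pose J x := hnorm x ^+ 2 - 2 * f x.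
(* J x >= |x|^2 - 2 c |x| = (|x| - c)^2 - c^2. *)
have J_lb x : - c ^+ 2 <= J x.
  have := sqr_ge0 (hnorm x - c); have := bphi x; rewrite -/(f x) /J => ? ?; nra.
pose E := [set J x | x in [set: H]].
have infE : has_inf E.
  split; first by exists (J 0), 0.
  by exists (- c ^+ 2) => _ [x _ <-].
pose m := inf E.
have mJ x : m <= J x by apply: ge_inf; [case: infE | exists x].
pose q : R := 2^-1.
have q0 : 0 < q by rewrite invr_gt0.
have /choice[u hu] : forall k, exists x, J x < m + (q ^+ k) ^+ 2.
  move=> k; have qk : 0 < (q ^+ k) ^+ 2 by rewrite !exprn_gt0.
  by have [_ [x _ <-] hx] := inf_adherent qk infE; exists x.
(* In this form of the parallelogram law the linear parts of J cancel; the midpoint value is at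
   least m, so near-minimisers are close to each other. *)
have par x y : hnorm (x - y) ^+ 2 = 2 * J x + 2 * J y - 4 * J (q%:C *: (x + y)).
  rewrite /J fZ fD hnormZ exprMn (ger0_norm (ltW q0)) hnormB_sqr hnormD_sqr.
  have -> : q = 2^-1 by [].
  by field.
have [k|z hz] := complete_geometric (u := u) (C := 2) half_itv.
  have qk : 0 < q ^+ k by rewrite exprn_gt0.
  apply: le_of_sqr; first by rewrite mulr_ge0 // ltW.
  rewrite par; have := hu k; have := hu k.+1; have := mJ (q%:C *: (u k.+1 + u k)).
  rewrite [q ^+ k.+1]exprS -/q => h1 h2 h3.
  have q4 : (q * q ^+ k) ^+ 2 <= (q ^+ k) ^+ 2.
    have /andP[_ /ltW q1] := half_itv.
    by rewrite ler_sqr ?nnegrE ?mulr_ge0 ?(ltW q0) ?(ltW qk) // ler_piMl // ltW.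
  rewrite exprMn; move: q4 h1 h2 h3; move: ((q * q ^+ k) ^+ 2) ((q ^+ k) ^+ 2) => Q' Q.
  by lra.
have Jz : J z <= m.
  rewrite -subr_le0; set D := 2 / (1 - 2^-1) in hz.
  have D0 : 0 <= D by rewrite divr_ge0 // subr_ge0 ltW; case/andP: half_itv.
  apply: (geometric_le0 (C := 1 + 2 * (hnorm z + c) * D) half_itv) => k.
  have zz := hnorm_ge0 z; have uz := hnorm_ge0 (u k); have hk := hz k.
  have b1 : hnorm z <= hnorm (u k) + D * q ^+ k.
    rewrite -[X in hnorm X <= _](subrK (u k)) addrC.
    by apply: le_trans (ler_hnormD _ _) _; rewrite lerD2l.
  have b3 : f (u k) <= f z + c * (D * q ^+ k).
    rewrite -lerBlDl -fN -fD; apply: le_trans (bphi _) _.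
    by rewrite ler_wpM2l // hnormBC.
  have qk : 0 < q ^+ k by rewrite exprn_gt0.
  have qk2 : (q ^+ k) ^+ 2 <= q ^+ k.
    rewrite expr2 ler_piMl ?(ltW qk) // exprn_ile1 ?(ltW q0) //.
    by have /andP[_ /ltW] := half_itv.
  have := hu k; rewrite /J => huk.
  have DQ : 0 <= D * q ^+ k by rewrite mulr_ge0 // ltW.
  have b4 : hnorm z ^+ 2 <= hnorm (u k) ^+ 2 + 2 * hnorm z * (D * q ^+ k).
    move: (D * q ^+ k) DQ b1 => d d0 b1.
    by have [zd|dz] := leP (hnorm z) d; nra.
  have -> : (1 + 2 * (hnorm z + c) * D) * q ^+ k
    = q ^+ k + 2 * (hnorm z + c) * (D * q ^+ k) by ring.
  move: b3 b4 huk qk2; rewrite -/q /J.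
  move: (D * q ^+ k) ((q ^+ k) ^+ 2) => d Q; lra.
have fz x : f x = rinner z x.
  pose b := rinner z x - f x; pose a := hnorm x ^+ 2.
  have a0 : 0 <= a by rewrite sqr_ge0.
  have ab (t : R) : 0 <= 2 * (t * b) + t ^+ 2 * a.
    have := le_trans Jz (mJ (z + t%:C *: x)).
    rewrite /J fD fZ hnormD_sqr hnormZ exprMn real_normK ?num_real // rinnerZr /a /b.
    by move=> ?; lra.
  have a1 : 0 < a + 1 by rewrite ltr_pwDr.
  (* The minimiser of 2 t b + t^2 a would be t = - b / a; the shift by 1 covers x = 0 and still
     forces b = 0. *)
  have := ab (- b / (a + 1)).
  have -> : 2 * (- b / (a + 1) * b) + (- b / (a + 1)) ^+ 2 * a
     = - ((b / (a + 1)) ^+ 2 * (a + 2)) by field; rewrite gt_eqF.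
  rewrite oppr_ge0 pmulr_lle0 ?ltr_pwDr // => b0.
  have /eqP : (b / (a + 1)) ^+ 2 = 0 by apply/le_anti; rewrite b0 sqr_ge0.
  rewrite sqrf_eq0 mulf_eq0 invr_eq0 (gt_eqF a1) orbF /b subr_eq0.
  by move/eqP.
exists z => x; apply/eqP; rewrite eq_complex; apply/andP; split; apply/eqP.
  by rewrite -/(f x) fz rinnerC.
(* The real part at - i x is the imaginary part at x. *)
have := fz (- 'i *: x); rewrite rinnerC /f /rinner innerZl phiZ.
by case: (phi x) => u1 v1; case: <(x, z)> => u2 v2 /=; lra.
Qed.

End Existence.

(** * Adjoints *)

Section Adjoint.
Context (R : realType).
Implicit Types H K : hilbertType R.

(** Riesz applied to x |-> <T x, y> gives the value at y; linearity and the bound c follow by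
    testing against all vectors. *)
Lemma adjoint_spec H K (T : H -> K) : bounded_ops T ->
  bounded_ops (adjoint T) /\ forall x y, <(T x, y)> = <(x, adjoint T y)>.
Proof.
move=> /bounded_opsE[lT [c c0 bT]].
apply: (@xgetPex _ _ [set S | bounded_ops S /\ forall x y, <(T x, y)> = <(x, S y)>]).
have /choice[S hS] : forall y, exists z, forall x, <(T x, y)> = <(x, z)>.
  move=> y; apply: (@riesz _ _ (fun x => <(T x, y)>) (c * hnorm y)).
  - by rewrite mulr_ge0 ?hnorm_ge0.
  - by move=> a x x'; rewrite lT innerDl innerZl.
  - move=> x; apply: le_trans (rinner_le _ _) _.
    by rewrite mulrAC ler_wpM2r ?hnorm_ge0.
exists S; split=> //; apply: (@bounded_opsI _ _ _ _ c) => [a x y|y].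
  apply: inner_ext => z; rewrite innerC -hS innerDr innerZr [RHS]innerC innerDr innerZr.
  by rewrite -!hS.
apply: hnorm_le_dual => [|z]; first by rewrite mulr_ge0 ?hnorm_ge0.
rewrite rinnerC /rinner -hS; apply: le_trans (rinner_le _ _) _.
by rewrite mulrAC ler_wpM2r ?hnorm_ge0.
Qed.

Lemma bounded_ops_adjoint H K (T : H -> K) : bounded_ops T -> bounded_ops (adjoint T).
Proof. by move=> /adjoint_spec[]. Qed.

Lemma adjointP H K (T : H -> K) x y : bounded_ops T -> <(T x, y)> = <(x, adjoint T y)>.
Proof. by move=> /adjoint_spec[]. Qed.

Lemma adjointPl H K (T : H -> K) x y : bounded_ops T -> <(adjoint T x, y)> = <(x, T y)>.
Proof. by move=> bT; rewrite innerC -adjointP // -innerC. Qed.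

Lemma adjoint_eq H K (T : H -> K) (S : K -> H) : bounded_ops T ->
  (forall x y, <(T x, y)> = <(x, S y)>) -> adjoint T = S.
Proof.
move=> bT h; apply/funext => y; apply: inner_ext => z.
by rewrite innerC -adjointP // h -innerC.
Qed.

End Adjoint.

(** * Inverses and the Neumann series *)

Section Inverse.
Context (R : realType).
Implicit Types H K : hilbertType R.

(** The lower bound gives both injectivity and the norm bound c^-1 of the inverse. *)
Lemma inv_op_spec H (T : H -> H) (c : R) : bounded_ops T -> 0 < c ->
  (forall x, c * hnorm x <= hnorm (T x)) -> (forall y, exists x, T x = y) ->
  [/\ bounded_ops (inv_op T), inv_op T \o T = id & T \o inv_op T = id].
Proof.
move=> /bounded_opsE[lT _] c0 bT sT.
apply: (@xgetPex _ _ [set S | [/\ bounded_ops S, S \o T = id & T \o S = id]]).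
have [S hS] := choice sT.
have injT x y : T x = T y -> x = y.
  move=> e; apply/eqP; rewrite -subr_eq0; apply/eqP/hnorm_eq0/le_anti.
  rewrite hnorm_ge0 andbT -(pmulr_rle0 _ c0); apply: le_trans (bT _) _.
  by rewrite linB // e subrr hnorm0.
exists S; split; last 2 first.
- by apply/funext => x /=; apply: injT.
- by apply/funext => x /=.
apply: (@bounded_opsI _ _ _ _ c^-1) => [a x y|y].
  by apply: injT; rewrite lT !hS.
by rewrite -(ler_pM2l c0) mulVKf ?gt_eqF // -[X in _ <= hnorm X]hS bT.
Qed.

Lemma neumann H (T : H -> H) (q : R) : linear T -> hbounded T q -> 0 <= q < 1 ->
  (forall x, (1 - q) * hnorm x <= hnorm ((id - T) x)) /\
  (forall y, exists x, (id - T) x = y).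
Proof.
move=> lT bT q01; have /andP[q0 q1] := q01; split=> [x|y].
  rewrite mulrBl mul1r lerBlDr !fctE.
  rewrite -[X in hnorm X <= _](subrK (T x)); apply: le_trans (ler_hnormD _ _) _.
  by rewrite lerD2l bT.
(* The partial sums of the Neumann series applied to y. *)
pose u k := iter k (fun x => y + T x) 0.
have du k : hnorm (u k.+1 - u k) <= hnorm y * q ^+ k.
  elim: k => [|k IH]; first by rewrite /u /= lin0 // addr0 subr0 expr0 mulr1.
  rewrite [u k.+2]/u [X in _ - X]/u !iterS -!/(u _) opprD addrACA subrr add0r -linB //.
  apply: le_trans (bT _) _; rewrite exprS mulrCA ler_wpM2l //.
have [x hx] := complete_geometric q01 du.
set D := hnorm y / (1 - q) in hx.
exists x; rewrite !fctE; apply/eqP; rewrite -subr_eq0; apply/eqP/hnorm_eq0/le_anti.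
(* One q is the error of the iterate k + 1, the other comes from applying T to the error of the
   iterate k. *)
rewrite hnorm_ge0 andbT; apply: (geometric_le0 (C := D * (q + q)) q01) => k.
have -> : x - T x - y = (x - u k.+1) + T (u k - x).
  by rewrite [u k.+1]/u iterS -/(u k) linB // opprD !addrA subrK addrAC.
apply: le_trans (ler_hnormD _ _) _; rewrite mulrDr mulrDl; apply: lerD.
  by rewrite -mulrA -exprS.
rewrite mulrAC mulrC; apply: le_trans (bT _) _; rewrite ler_wpM2l // hnormBC.
exact: hx.
Qed.

Lemma inv_op_neumann H (T : H -> H) (q : R) : bounded_ops T -> hbounded T q -> 0 <= q < 1 ->
  [/\ bounded_ops (inv_op (id - T)), inv_op (id - T) \o (id - T) = id
    & (id - T) \o inv_op (id - T) = id].
Proof.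
move=> bT qT q01; have [lo su] := neumann (bounded_ops_lin bT) qT q01.
apply: (inv_op_spec (c := 1 - q)) => //.
  by apply: bounded_opsB => //; exact: bounded_ops_id.
by rewrite subr_gt0; case/andP: q01.
Qed.

End Inverse.

(** * Positive operators and square roots *)

Section Positive.
Context (R : realType).
Implicit Types H K : hilbertType R.

(** In the order of [R[i]], being nonnegative includes being real, so the form [b] vanishes on the
    diagonal; polarising with x + y and i x + y kills it everywhere. *)
Lemma positive_op_sym H (T : H -> H) : linear T -> positive_op T ->
  forall x y, <(T x, y)> = <(x, T y)>.
Proof.
move=> lT pT x y.
pose b u v := <(T u, v)> - <(u, T v)>.
have bxx u : b u u = 0.
  rewrite /b [<(u, T u)>]innerC; have := pT u.
  by rewrite lecE; case: <(T u, u)> => c d /= /andP[/eqP -> _]; rewrite /= oppr0 subrr.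
have bD : b x y + b y x = 0.
  have := bxx (x + y); rewrite /b linD // !innerDl !innerDr.
  by have := bxx x; have := bxx y; rewrite /b => /eqP; rewrite subr_eq0 => /eqP -> /eqP; rewrite subr_eq0 => /eqP -> <-; ring.
have biD : b x y - b y x = 0.
  have i2 : ('i%C : R[i])^*%C = - 'i%C by rewrite /= ; congr Complex; rewrite oppr0.
  have ni : ('i%C : R[i]) != 0 by rewrite eq_complex /= oner_eq0 andbF.
  have := bxx ('i%C *: x + y); rewrite /b linD // linZ // !innerDl !innerDr !innerZl !innerZr i2.
  have := bxx x; have := bxx y; rewrite /b => /eqP; rewrite subr_eq0 => /eqP -> /eqP; rewrite subr_eq0 => /eqP -> h.
  apply: (mulfI ni); rewrite mulr0 -h /b; ring.
have : 2 * b x y = 0 by rewrite -(addr0 0) -{1}bD -biD; ring.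
by move/eqP; rewrite mulf_eq0 pnatr_eq0 /= /b subr_eq0 => /eqP.
Qed.

(* [id - S] with [S = (T + S \o S) / 2], found by fixed-point iteration in the
   ball of radius [1 - sqrt (1 - q)]. *)
Lemma sqrt_exists H (T : H -> H) (q : R) : linear T -> hbounded T q -> 0 <= q < 1 ->
  (forall x y, <(T x, y)> = <(x, T y)>) ->
  exists S : H -> H, [/\ bounded_ops S, positive_op S & S \o S = id - T].
Proof.
move=> lT bT /andP[q0 q1] sT.
pose p : R := 1 - Num.sqrt (1 - q).
have s2 : Num.sqrt (1 - q) ^+ 2 = 1 - q by rewrite sqr_sqrtr // subr_ge0 ltW.
have s0 : 0 < Num.sqrt (1 - q) by rewrite sqrtr_gt0 subr_gt0.
have p1 : p < 1 by rewrite /p; lra.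
have p0 : 0 <= p by rewrite /p; nra.
(* The scalar version of the fixed-point equation: the ball of radius p is preserved by the
   iteration. *)
have pE : q + p ^+ 2 = 2 * p by rewrite /p; nra.
pose h : R[i] := (2^-1)%:C.
pose step (S : H -> H) x := h *: (T x + S (S x)).
pose Y k := iter k step (fun=> 0).
have YS k x : Y k.+1 x = h *: (T x + Y k (Y k x)) by [].
have Ylin k : linear (Y k).
  elim: k => [|k IH] a x y; first by rewrite /Y /= scaler0 addr0.
  rewrite !YS lT !IH scalerA mulrC -scalerA -scalerDr; congr (_ *: _).
  by rewrite scalerDr addrACA.
have h0 : `|2^-1 : R| = 2^-1 by rewrite ger0_norm ?invr_ge0.
have Ybnd k : hbounded (Y k) p.
  elim: k => [|k IH] x; first by rewrite /Y /= hnorm0 mulr_ge0 // hnorm_ge0.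
  rewrite YS hnormZ h0.
  have : hnorm (T x + Y k (Y k x)) <= q * hnorm x + p * (p * hnorm x).
    by apply: le_trans (ler_hnormD _ _) _; rewrite lerD // (le_trans (IH _)) // ler_wpM2l.
  have -> : q * hnorm x + p * (p * hnorm x) = 2 * (p * hnorm x) by rewrite mulrA -mulrDl -expr2 pE mulrA.
  by move: (hnorm (_ + _)) => t; lra.
have Ysym k x y : <(Y k x, y)> = <(x, Y k y)>.
  elim: k x y => [|k IH] x y; first by rewrite /Y /= inner0l inner0r.
  by rewrite !YS innerZl innerZr innerDl innerDr sT !IH /h conjc_real.
have Ydiff k x : hnorm (Y k.+1 x - Y k x) <= hnorm x * p ^+ k.
  elim: k x => [|k IH] x.
    rewrite (_ : Y 0%N x = 0) // subr0 expr0 mulr1; apply: le_trans (Ybnd _ _) _.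
    by rewrite ler_piMl ?hnorm_ge0 // ltW.
  rewrite YS [Y k.+1 x]YS -scalerBr hnormZ h0 opprD addrACA subrr add0r.
  (* A difference of squares written so that no commutation is required; each half is at most p *
     p^k |x|, and the factor 1/2 restores the rate p. *)
  have -> : Y k.+1 (Y k.+1 x) - Y k (Y k x)
      = Y k.+1 (Y k.+1 x - Y k x) + (Y k.+1 (Y k x) - Y k (Y k x)).
    by rewrite (linB (Ylin _)) addrA subrK.
  set A := Y k.+1 (_ - _); set B := _ - _.
  have hA : hnorm A <= p * (hnorm x * p ^+ k).
    by apply: le_trans (Ybnd _ _) _; rewrite ler_wpM2l.
  have hB : hnorm B <= p * (hnorm x * p ^+ k).
    by apply: le_trans (IH _) _; rewrite mulrA ler_wpM2r ?exprn_ge0 //; apply: Ybnd.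
  have := le_trans (ler_hnormD A B) (lerD hA hB).
  by rewrite exprS; move: (hnorm (A + B)) (p ^+ k) => t u; lra.
have p01 : 0 <= p < 1 by rewrite p0.
have /choice[Z hZ] : forall x, exists z, forall k, hnorm (z - Y k x) <= hnorm x / (1 - p) * p ^+ k.
  by move=> x; apply: complete_geometric => // k; exact: Ydiff.
have Z_eq x z C : (forall k, hnorm (z - Y k x) <= C * p ^+ k) -> z = Z x.
  move=> hz; apply/eqP; rewrite -subr_eq0; apply/eqP/hnorm_eq0/le_anti.
  rewrite hnorm_ge0 andbT; apply: (geometric_le0 (C := C + hnorm x / (1 - p)) p01) => k.
  rewrite (le_trans (hnorm_triangle _ (Y k x) _)) // mulrDl lerD //.
  by rewrite hnormBC.
have Zlin : linear Z.
  move=> a x y; apply/esym; apply: (@Z_eq _ _ (complex.Re `|a| * (hnorm x / (1 - p)) + hnorm y / (1 - p))) => k.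
  rewrite Ylin opprD addrACA -scalerBr; apply: le_trans (ler_hnormD _ _) _.
  rewrite mulrDl hnormZC lerD // -mulrA ler_wpM2l //.
  by rewrite -ler0c RRe_real ?ger0_real.
have Zbnd : hbounded Z p.
  move=> x; rewrite -subr_le0.
  apply: (geometric_le0 (C := hnorm x / (1 - p)) p01) => k.
  have := hZ x k; have := Ybnd k x.
  have : hnorm (Z x) <= hnorm (Z x - Y k x) + hnorm (Y k x).
    by rewrite -[X in hnorm X <= _](subrK (Y k x)) ler_hnormD.
  by move: (_ / _ * _) => u; lra.
have Zfix x : Z x = h *: (T x + Z (Z x)).
  apply/esym; apply: (@Z_eq _ _ (hnorm x / (1 - p) + hnorm (Z x) / (1 - p) + hnorm x)) => k.
  have -> : h *: (T x + Z (Z x)) - Y k x =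
     h *: ((Z (Z x) - Y k (Z x)) + Y k (Z x - Y k x)) + (Y k.+1 x - Y k x).
    rewrite YS addrA -scalerDr; congr (h *: _ - _).
    by rewrite (linB (Ylin _)) [X in _ = X + _]addrA subrK addrACA addNr addr0 addrC.
  apply: le_trans (ler_hnormD _ _) _; rewrite mulrDl lerD //.
  rewrite hnormZ h0.
  have h1 := le_trans (ler_hnormD (Z (Z x) - Y k (Z x)) (Y k (Z x - Y k x))) (lerD (hZ _ k) (Ybnd k _)).
  have h2 : p * hnorm (Z x - Y k x) <= 1 * (hnorm x / (1 - p) * p ^+ k).
    by apply: ler_pM; rewrite ?hnorm_ge0 ?(ltW p1) ?hZ.
  have h3 : 0 <= hnorm (Z x) / (1 - p) * p ^+ k.
    by rewrite mulr_ge0 ?exprn_ge0 // divr_ge0 ?hnorm_ge0 // subr_ge0 ltW.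
  have h4 : 0 <= hnorm x / (1 - p) * p ^+ k.
    by rewrite mulr_ge0 ?exprn_ge0 // divr_ge0 ?hnorm_ge0 // subr_ge0 ltW.
  rewrite mulrDl; move: h1 h2 h3 h4.
  move: (hnorm (_ + _)) (p * _) (_ * p ^+ k) (_ * p ^+ k) => a b c d; lra.
have Zsym x y : <(Z x, y)> = <(x, Z y)>.
  have re u v : rinner (Z u) v = rinner u (Z v).
    have key u' v' : rinner (Z u') v' - rinner u' (Z v') <= 0.
      apply: (geometric_le0 (C := hnorm u' / (1 - p) * hnorm v' + hnorm u' * (hnorm v' / (1 - p))) p01) => k.
      have -> : rinner (Z u') v' - rinner u' (Z v') = rinner (Z u' - Y k u') v' + rinner u' (Y k v' - Z v').
        rewrite !rinnerDl !rinnerDr !rinnerNl !rinnerNr.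
        by rewrite (_ : rinner (Y k u') v' = rinner u' (Y k v')) 1?/rinner ?Ysym //; ring.
      rewrite mulrDl lerD // (le_trans (rinner_le _ _)) //.
        by rewrite mulrAC ler_wpM2r ?hnorm_ge0.
      by rewrite -mulrA ler_wpM2l ?hnorm_ge0 // hnormBC.
    apply/le_anti/andP; split; first by rewrite -subr_le0.
    by rewrite -subr_le0 [rinner u _]rinnerC [rinner _ v]rinnerC.
  by rewrite !innerE re re linZ.
pose S := id - Z.
have SE x : S x = x - Z x by [].
exists S; split.
- apply: bounded_opsB; first exact: bounded_ops_id.
  exact: bounded_opsI Zbnd.
- move=> x; rewrite SE innerDl innerNl inner_xx.
  have -> : <(Z x, x)> = (rinner (Z x) x)%:C.
    apply/eqP; rewrite eq_complex /= eqxx /=; have := Zsym x x; rewrite [RHS]innerC.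
    by case: <(Z x, x)> => a b [] /= hb; apply/eqP; lra.
  rewrite -rmorphB ler0c subr_ge0 (le_trans (rinner_le _ _)) // expr2.
  by rewrite ler_wpM2r ?hnorm_ge0 // (le_trans (Zbnd _)) // ler_piMl ?hnorm_ge0 // ltW.
- apply/funext => x /=; rewrite !SE (linB Zlin) !fctE opprB addrA.
  (* The fixed-point equation reads Z^2 = 2 Z - T, so (1 - Z)^2 = 1 - T. *)
  have -> : Z (Z x) = Z x + Z x - T x.
    have h2 : h + h = 1 by rewrite /h -rmorphD /= (_ : 2^-1 + 2^-1 = 1 :> R) //; lra.
    by rewrite {2 3}(Zfix x) -scalerDl h2 scale1r addrC addKr.
  by rewrite !addrA subrK addrAC addrK.
Qed.

Lemma sqrt_op_spec H (T : H -> H) (q : R) : bounded_ops T -> hbounded T q -> 0 <= q < 1 ->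
  (forall x y, <(T x, y)> = <(x, T y)>) ->
  [/\ bounded_ops (sqrt_op (id - T)), positive_op (sqrt_op (id - T))
    & sqrt_op (id - T) \o sqrt_op (id - T) = id - T].
Proof.
move=> [lT _] bT q01 sT.
apply: (@xgetPex _ _ [set S | [/\ bounded_ops S, positive_op S & S \o S = id - T]]).
exact: sqrt_exists bT q01 sT.
Qed.

End Positive.

(** * Row contractions *)

Section Opnorm.
Context (R : realType).
Implicit Types H K : hilbertType R.

Lemma opnorm_le H K (T : H -> K) (c : R) : 0 <= c -> hbounded T c -> opnorm T <= c.
Proof.
move=> c0 bT; apply: ge_sup.
  by exists (hnorm (T 0)), 0 => //=; rewrite normr0.
move=> _ [x /= x1 <-]; apply: le_trans (bT x) _.
by move: x1; rewrite hnormE -(rmorph1 (real_complex R)) lecR => x1; rewrite ler_piMr.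
Qed.

(** Boundedness makes the [sup] in [opnorm] a genuine supremum instead of a default value;
    normalising x gives the rest. *)
Lemma opnormP H K (T : H -> K) : bounded_ops T -> hbounded T (opnorm T).
Proof.
move=> /bounded_opsE[lT [c c0 bT]] x.
have [x0|nx0] := eqVneq (hnorm x) 0.
  by rewrite (hnorm_eq0 x0) lin0 // !hnorm0 mulr0.
have px : 0 < hnorm x by rewrite lt_def nx0 hnorm_ge0.
rewrite -ler_pdivrMr // mulrC.
have -> : (hnorm x)^-1 * hnorm (T x) = hnorm (T ((hnorm x)^-1%:C *: x)).
  by rewrite linZ // hnormZ ger0_norm // invr_ge0 ltW.
apply: ub_le_sup; last first.
  exists ((hnorm x)^-1%:C *: x) => //=.
  by rewrite hnormE hnormZ ger0_norm ?invr_ge0 ?(ltW px) // mulVf //; exact: lexx.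
exists c => _ [y /= y1 <-]; apply: le_trans (bT y) _.
by move: y1; rewrite hnormE -(rmorph1 (real_complex R)) lecR => y1; rewrite ler_piMr.
Qed.

Lemma opnorm_ge0 H K (T : H -> K) : bounded_ops T -> 0 <= opnorm T.
Proof.
move=> /bounded_opsE[lT [c c0 bT]]; apply: ub_le_sup; last first.
  by exists 0 => /=; [rewrite normr0 | rewrite lin0 // normr0].
exists c => _ [y /= y1 <-]; apply: le_trans (bT y) _.
by move: y1; rewrite hnormE -(rmorph1 (real_complex R)) lecR => y1; rewrite ler_piMr.
Qed.

End Opnorm.

Section Rows.
Context (R : realType) (n : nat).
Implicit Types H K : hilbertType R.

Lemma bounded_ops_row_square H (X : 'I_n -> H -> H) : (forall i, bounded_ops (X i)) ->
  bounded_ops (row_square X).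
Proof.
move=> bX; apply: bounded_ops_sum => i _.
by apply: bounded_ops_comp => //; exact: bounded_ops_adjoint.
Qed.

Lemma row_square_inner H (X : 'I_n -> H -> H) x y : (forall i, bounded_ops (X i)) ->
  <(row_square X x, y)> = \sum_(i < n) <(adjoint (X i) x, adjoint (X i) y)>.
Proof.
by move=> bX; rewrite /row_square sum_fctE inner_suml; apply: eq_bigr => i _; rewrite /= adjointP.
Qed.

Lemma row_square_sym H (X : 'I_n -> H -> H) x y : (forall i, bounded_ops (X i)) ->
  <(row_square X x, y)> = <(x, row_square X y)>.
Proof.
move=> bX; rewrite [RHS]innerC !row_square_inner // rmorph_sum; apply: eq_bigr => i _.
exact: innerC.
Qed.

Lemma row_norm_sqr H (X : 'I_n -> H -> H) : (forall i, bounded_ops (X i)) ->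
  row_norm X ^+ 2 = opnorm (row_square X).
Proof. by move=> bX; rewrite sqr_sqrtr // opnorm_ge0 //; exact: bounded_ops_row_square. Qed.

Lemma row_adjoint_le H (X : 'I_n -> H -> H) x : (forall i, bounded_ops (X i)) ->
  \sum_(i < n) hnorm (adjoint (X i) x) ^+ 2 <= row_norm X ^+ 2 * hnorm x ^+ 2.
Proof.
move=> bX; rewrite row_norm_sqr //.
have -> : \sum_(i < n) hnorm (adjoint (X i) x) ^+ 2 = rinner (row_square X x) x.
  rewrite /rinner row_square_inner // raddf_sum; apply: eq_bigr => i _.
  by rewrite hnorm_sqr.
apply: le_trans (rinner_le _ _) _; rewrite expr2 mulrA ler_wpM2r ?hnorm_ge0 //.
by apply: opnormP; exact: bounded_ops_row_square.
Qed.

(* Duality with [row_adjoint_le], by the AM-GM inequality. *)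
Lemma row_contraction H (X : 'I_n -> H -> H) (y : 'I_n -> H) : closed_row_ball X ->
  hnorm (\sum_(i < n) X i (y i)) ^+ 2 <= \sum_(i < n) hnorm (y i) ^+ 2.
Proof.
move=> [bX X1]; set z := \sum_(i < n) _.
have h1 : \sum_(i < n) hnorm (adjoint (X i) z) ^+ 2 <= hnorm z ^+ 2.
  apply: le_trans (row_adjoint_le _ bX) _; rewrite ler_piMl ?sqr_ge0 //.
  by rewrite exprn_ile1 // sqrtr_ge0.
have h2 : 2 * hnorm z ^+ 2 <= \sum_(i < n) hnorm (y i) ^+ 2 + \sum_(i < n) hnorm (adjoint (X i) z) ^+ 2.
  rewrite hnorm_sqr {1}/z rinner_suml mulr_sumr -big_split; apply: ler_sum => i _ /=.
  rewrite /rinner adjointP // -/(rinner _ _).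
  by have := sqr_ge0 (hnorm (y i - adjoint (X i) z)); rewrite hnormB_sqr; lra.
lra.
Qed.

End Rows.

(** * The Poisson form of a row contraction *)

Section Kernel.
Context (R : realType) (n : nat).
Implicit Types H K : hilbertType R.

Definition wsum H (X : 'I_n -> H -> H) (s : seq (seq 'I_n * H)) : H :=
  \sum_(x <- s) word_op X x.1 x.2.

(* If [V] dilates [X] then [V_v^* V_(v g)] compresses to [X_g], and [V_v^* V_w]
   to [0] when neither of [v], [w] is a prefix of the other. *)
Definition toeplitz H (X : 'I_n -> H -> H) (x y : seq 'I_n * H) : R[i] :=
  if prefix y.1 x.1 then <(word_op X (drop (size y.1) x.1) x.2, y.2)> else 0.

(** [toeplitz] records only the case where [y.1] is a prefix of [x.1]; twice the real part accounts
    for the mirror pair, and the diagonal, thereby counted twice, is subtracted once. *)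
Definition poisson_term H (X : 'I_n -> H -> H) (x y : seq 'I_n * H) : R :=
  2 * complex.Re (toeplitz X x y) - (x.1 == y.1)%:R * rinner x.2 y.2.

(* With [C_X h = (Delta (x) I) (I - R_X)^-1 h], this is [|C_X h| ^ 2] at
   [h = \sum_(x <- s) x.2 (x) e_(x.1)]. *)
Definition poisson H (X : 'I_n -> H -> H) (s : seq (seq 'I_n * H)) : R :=
  \sum_(x <- s) \sum_(y <- s) poisson_term X x y.

Lemma linear_word_op H (X : 'I_n -> H -> H) w : (forall i, linear (X i)) -> linear (word_op X w).
Proof. by move=> lX; elim: w => //= i w IH a x y /=; rewrite IH lX. Qed.

Lemma bounded_ops_word_op H (X : 'I_n -> H -> H) w :
  (forall i, bounded_ops (X i)) -> bounded_ops (word_op X w).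
Proof.
by move=> lX; elim: w => [|i w IH]; [exact: bounded_ops_id | exact: bounded_ops_comp].
Qed.

Lemma word_op_cat H (X : 'I_n -> H -> H) v w x :
  word_op X (v ++ w) x = word_op X v (word_op X w x).
Proof. by elim: v => //= i v ->. Qed.

(** With [vacuum_part], this is the partition of the free semigroup into the identity and the words
    with a given first letter. *)
Definition tails H (s : seq (seq 'I_n * H)) (i : 'I_n) : seq (seq 'I_n * H) :=
  [seq (behead x.1, x.2) | x <- s & ohead x.1 == Some i].

Definition vacuum_part H (s : seq (seq 'I_n * H)) := [seq x <- s | nilp x.1].

Lemma big_tails H (V : zmodType) (s : seq (seq 'I_n * H)) (f : seq 'I_n * H -> V) :
  \sum_(x <- s) f x =
  \sum_(x <- vacuum_part s) f x + \sum_(i < n) \sum_(x <- tails s i) f (i :: x.1, x.2).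
Proof.
elim: s => [|[w h] s IH].
  by rewrite !big_nil big1 ?addr0 // => i _; rewrite /tails /= big_nil.
rewrite big_cons {}IH /vacuum_part /=; case: w => [|j w] /=.
  by rewrite big_cons addrA.
rewrite addrCA; congr (_ + _).
rewrite (bigD1 j) // [RHS](bigD1 j) //= addrA; congr (_ + _).
  by rewrite /tails /= eqxx /= big_cons.
by apply: eq_bigr => i ij; rewrite /tails /= (inj_eq Some_inj) eq_sym (negbTE ij).
Qed.

(** A common first letter can be cancelled from a Toeplitz entry, and different first letters make
    it vanish. What remains are the pairs with an empty word, which give the first two terms. *)
Lemma poisson_split H (X : 'I_n -> H -> H) s : (forall i, linear (X i)) ->
  poisson X s = hnorm (wsum X (vacuum_part s)) ^+ 2
   + 2 * rinner (\sum_(i < n) X i (wsum X (tails s i))) (wsum X (vacuum_part s))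
   + \sum_(i < n) poisson X (tails s i).
Proof.
move=> lX.
have nilv (f : seq 'I_n * H -> R) : \sum_(x <- vacuum_part s) f x = \sum_(x <- vacuum_part s) f ([::], x.2).
  rewrite !big_filter; apply: eq_bigr => -[w h] /=.
  by rewrite /nilp size_eq0 => /eqP ->.
have wv : wsum X (vacuum_part s) = \sum_(x <- vacuum_part s) x.2.
  rewrite /wsum !big_filter; apply: eq_bigr => -[w h] /=.
  by rewrite /nilp size_eq0 => /eqP ->.
rewrite {1}/poisson big_tails nilv -addrA; congr (_ + _).
  rewrite hnorm_sqr wv rinner_suml; apply: eq_bigr => x _.
  rewrite big_tails nilv [X in _ + X]big1 ?addr0 => [|i _].
    rewrite rinner_sumr; apply: eq_bigr => y _.
    by rewrite /poisson_term /toeplitz /= -/(rinner _ _); ring.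
  by rewrite big1 // => y _; rewrite /poisson_term /toeplitz /= mulr0 mul0r subr0.
rewrite rinner_suml mulr_sumr -big_split; apply: eq_bigr => i _ /=.
rewrite (lin_sum (lX i)) rinner_suml mulr_sumr -big_split; apply: eq_bigr => x _ /=.
rewrite big_tails nilv; congr (_ + _).
  rewrite wv rinner_sumr mulr_sumr; apply: eq_bigr => y _.
  by rewrite /poisson_term /toeplitz /= mul0r subr0.
rewrite (bigD1 i) //= [X in _ + X]big1 ?addr0 => [|j ji].
  by apply: eq_bigr => y _; rewrite /poisson_term /toeplitz /= eqseq_cons eqxx.
rewrite big1 // => y _.
by rewrite /poisson_term /toeplitz /= eqseq_cons (eq_sym i j) (negbTE ji) mulr0 mul0r subr0.
Qed.

Lemma wsum_tails H (X : 'I_n -> H -> H) s : (forall i, linear (X i)) ->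
  wsum X s = wsum X (vacuum_part s) + \sum_(i < n) X i (wsum X (tails s i)).
Proof.
move=> lX; rewrite {1}/wsum big_tails; congr (_ + _); apply: eq_bigr => i _.
by rewrite (lin_sum (lX i)).
Qed.

(* Induction on the length of the words, splitting off their first letters. *)
Lemma poisson_ge H (X : 'I_n -> H -> H) s : closed_row_ball X ->
  hnorm (wsum X s) ^+ 2 <= poisson X s.
Proof.
move=> cX; have lX i : linear (X i) by have [/(_ i)[]] := cX.
have [N] : exists N, all (fun x : seq 'I_n * H => size x.1 < N)%N s.
  elim: s => [|x s [N hN]]; first by exists 0%N.
  exists (maxn (size x.1).+1 N) => /=; rewrite leq_maxl /=.
  by apply: sub_all hN => y hy; rewrite (leq_trans hy) // leq_maxr.
elim: N s => [|N IH] s hN.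
  have -> : s = [::] by case: s hN.
  by rewrite /wsum /poisson !big_nil hnorm0 expr0n.
(* The square and the cross term agree on both sides; row contractivity and the induction hypothesis
   handle the tails. *)
rewrite poisson_split // wsum_tails // hnormD_sqr (rinnerC (wsum _ _)) lerD2l.
apply: le_trans (row_contraction (fun i => wsum X (tails s i)) cX) _.
apply: ler_sum => i _; apply: IH; rewrite all_map all_filter.
by apply: sub_all hN => -[[|j w] h] //= hw; apply/implyP.
Qed.

End Kernel.

Section Gram.
Context (R : realType) (n : nat).
Implicit Types H K : hilbertType R.

(** The Hermitian form of the kernel: for different words at most one of the two Toeplitz entries is
    nonzero, for equal words both are and one is removed. *)
Definition gram_term H (X : 'I_n -> H -> H) (x y : seq 'I_n * H) : R[i] :=
  toeplitz X x y + (toeplitz X y x)^*%C - (x.1 == y.1)%:R * <(x.2, y.2)>.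

Lemma poisson_gram H (X : 'I_n -> H -> H) (s : seq (seq 'I_n * H)) :
  poisson X s = \sum_(x <- s) \sum_(y <- s) complex.Re (gram_term X x y).
Proof.
have e x y : complex.Re (gram_term X x y) =
    complex.Re (toeplitz X x y) + complex.Re (toeplitz X y x) - (x.1 == y.1)%:R * rinner x.2 y.2.
  rewrite /gram_term raddfB raddfD /= /rinner; congr (_ + _ - _).
    by case: (toeplitz X y x).
  by case: (_ == _); rewrite ?mul1r ?mul0r.
under [RHS]eq_bigr do under eq_bigr do rewrite e -addrA.
under [RHS]eq_bigr do rewrite big_split.
rewrite big_split /=; under [X in _ + X]eq_bigr do rewrite big_split.
rewrite big_split /= [X in _ + (X + _)]exchange_big /= /poisson.
rewrite -!big_split; apply: eq_bigr => x _ /=; rewrite -!big_split; apply: eq_bigr => y _ /=.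
by rewrite /poisson_term; ring.
Qed.

Lemma sqr_hnorm_sum H I (s : seq I) (f : I -> H) :
  hnorm (\sum_(x <- s) f x) ^+ 2 = \sum_(x <- s) \sum_(y <- s) complex.Re <(f x, f y)>.
Proof.
by rewrite hnorm_sqr rinner_suml; apply: eq_bigr => x _; rewrite rinner_sumr.
Qed.

Lemma isometry_inner H K (J : H -> K) x y : bounded_ops J ->
  (forall h, hnorm (J h) = hnorm h) -> <(J x, J y)> = <(x, y)>.
Proof.
move=> [lJ _] iJ.
have re u v : rinner (J u) (J v) = rinner u v.
  have := hnormD_sqr (J u) (J v); rewrite -linD // !iJ hnormD_sqr; lra.
by rewrite !innerE -linZ // !re.
Qed.

End Gram.

(** * The Gram matrix of a minimal isometric dilation *)

Section Dilation.
Context (R : realType) (n : nat) (H K : hilbertType R).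
Variables (A : 'I_n -> H -> H) (J : H -> K) (V : 'I_n -> K -> K).
Hypotheses (dil : minimal_isometric_dilation A J V) (bA : forall i, bounded_ops (A i)).

Let bV i : bounded_ops (V i). Proof. by case: (mid_isom dil i). Qed.

Let isoV i x : hnorm (V i x) = hnorm x.
Proof. by have [_ h] := mid_isom dil i; rewrite /hnorm h. Qed.

Let isoJ x : hnorm (J x) = hnorm x.
Proof. by have [_ h] := mid_incl dil; rewrite /hnorm h. Qed.

Let bJ : bounded_ops J. Proof. by have [] := mid_incl dil. Qed.

(** Evaluate [mid_row] at V_j y: the term of index j alone already exhausts |y|^2, so the other
    adjoints vanish there. *)
Lemma dilation_orthogonal i j x y : i != j -> <(V i x, V j y)> = 0.
Proof.
move=> ij; rewrite adjointP //.
suff -> : adjoint (V i) (V j y) = 0 by rewrite inner0r.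
apply/hnorm_eq0/eqP; rewrite -sqrf_eq0; apply/eqP/le_anti; rewrite sqr_ge0 andbT.
have := mid_row dil (V j y).
rewrite !fctE innerDl innerNl row_square_inner // inner_xx isoV.
have -> : \sum_(k < n) <(adjoint (V k) (V j y), adjoint (V k) (V j y))>
   = (\sum_(k < n) hnorm (adjoint (V k) (V j y)) ^+ 2)%:C.
  by rewrite rmorph_sum; apply: eq_bigr => k _; rewrite inner_xx.
rewrite -rmorphB ler0c (bigD1 j) //= (bigD1 i) //=.
have -> : adjoint (V j) (V j y) = y.
  by apply: inner_ext => z; rewrite adjointPl // isometry_inner.
have : 0 <= \sum_(k < n | (k != j) && (k != i)) hnorm (adjoint (V k) (V j y)) ^+ 2.
  by apply: sumr_ge0 => k _; rewrite sqr_ge0.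
by move: (\sum_(k < n | _) _) => S; lra.
Qed.

Lemma dilation_compress w a b : <(word_op V w (J a), J b)> = <(word_op A w a, b)>.
Proof.
elim: w b => [|i w IH] b /=; first exact: isometry_inner.
by rewrite adjointP // (mid_adj dil) IH -adjointP.
Qed.

(** Common first letters cancel because the V_i are isometric, different ones give orthogonal
    vectors, and once a word is used up [dilation_compress] evaluates the rest. *)
Lemma dilation_gram x y :
  <(word_op V x.1 (J x.2), word_op V y.1 (J y.2))> = gram_term A x y.
Proof.
case: x y => [v a] [w b] /=; rewrite /gram_term /toeplitz /=.
elim: v w => [|i v IH] [|j w] /=.
- by rewrite isometry_inner // mul1r -innerC addrK.
- rewrite mul0r subr0 add0r [LHS]innerC; congr (_^*%C).
  exact: (dilation_compress (j :: w)).
- by rewrite mul0r subr0 oppr0 addr0; exact: (dilation_compress (i :: v)).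
- rewrite eqseq_cons [j == i]eq_sym; case: eqP => [->|/eqP ij] /=.
    by rewrite isometry_inner // IH.
  by rewrite dilation_orthogonal // oppr0 mul0r subr0 addr0.
Qed.

Lemma dilation_poisson s :
  hnorm (\sum_(x <- s) word_op V x.1 (J x.2)) ^+ 2 = poisson A s.
Proof.
rewrite sqr_hnorm_sum poisson_gram; apply: eq_bigr => x _; apply: eq_bigr => y _.
by rewrite dilation_gram.
Qed.

End Dilation.

(** * Radial scaling as a Schur multiplier *)

Section Schur.
Context (R : realType) (n : nat).
Implicit Types H : hilbertType R.

Lemma word_op_scale H (X : 'I_n -> H -> H) r w x : (forall i, linear (X i)) ->
  word_op (scale_tuple r X) w x = (r ^+ size w)%:C *: word_op X w x.
Proof.
move=> lX; elim: w => [|i w IH] /=; first by rewrite expr0 scale1r.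
by rewrite IH /scale_tuple !fctE linZ // scalerA -rmorphM -exprS.
Qed.

(** The truncated subtraction in the exponent is harmless: where it truncates, [y.1] is not a prefix
    of [x.1] and the term is zero. *)
Lemma poisson_term_scale H (X : 'I_n -> H -> H) r x y : (forall i, linear (X i)) ->
  poisson_term (scale_tuple r X) x y = r ^+ (size x.1 - size y.1) * poisson_term X x y.
Proof.
move=> lX; rewrite /poisson_term /toeplitz.
case: ifPn => [pxy|npxy]; last first.
  have -> : (x.1 == y.1) = false by apply: contraNF npxy => /eqP ->; exact: prefix_refl.
  by rewrite /= mulr0 !mul0r subrr mulr0.
rewrite word_op_scale // size_drop innerZl mulrBr; congr (_ - _).
  by case: <(_, _)> => a b /=; ring.
by case: eqP => [->|_]; rewrite ?subnn ?expr0 ?mul1r ?mul0r ?mulr0.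
Qed.

Lemma poisson_termZ H (X : 'I_n -> H -> H) (a b : R) v w x y : (forall i, linear (X i)) ->
  poisson_term X (v, a%:C *: x) (w, b%:C *: y) = a * b * poisson_term X (v, x) (w, y).
Proof.
move=> lX; rewrite /poisson_term /toeplitz /= rinnerZl rinnerZr.
case: ifP => _; last by rewrite /=; ring.
rewrite linZ; last exact: linear_word_op.
by rewrite -/(rinner _ _) -[complex.Re <(word_op _ _ x, y)>]/(rinner _ _) rinnerZl rinnerZr; ring.
Qed.

(** Chosen so that the sum of the weights times r^(2 (j - k)) over k <= j telescopes to 1;
    nonnegative for 0 <= r <= 1. *)
Let schur_weight (r : R) (k : nat) : R := if k is 0%N then 1 else 1 - r ^+ 2.

(* The Schur multiplier turning [X] into [r X] is [r ^ |i - j|], a positive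
   combination of rank-one kernels. *)
Lemma schur_weight_sum (r : R) (N i j : nat) : (j <= i <= N)%N ->
  \sum_(k < N.+1) schur_weight r k *
    (((k <= i)%:R * r ^+ (i - k)) * ((k <= j)%:R * r ^+ (j - k))) = r ^+ (i - j).
Proof.
move=> /andP[ji iN].
have jN : (j.+1 <= N.+1)%N by rewrite ltnS (leq_trans ji).
rewrite (eq_bigr (fun k : 'I_N.+1 => if (k < j.+1)%N then
  r ^+ (i - j) * (schur_weight r k * (r ^+ (j - k)) ^+ 2) else 0)); last first.
  move=> k _; rewrite ltnS; case: (leqP k j) => [kj|_]; last by rewrite /= mul0r !mulr0.
  rewrite (leq_trans kj ji) !mul1r.
  have -> : (i - k = (i - j) + (j - k))%N by rewrite addnBA // subnK.
  by rewrite exprD; ring.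
rewrite -big_mkcond /= -(big_ord_widen_cond _ xpredT (fun k => r ^+ (i - j) * (schur_weight r k * (r ^+ (j - k)) ^+ 2)) jN) -mulr_sumr.
suff -> : \sum_(k < j.+1) schur_weight r k * (r ^+ (j - k)) ^+ 2 = 1 by rewrite mulr1.
elim: j {ji jN} => [|j IH]; first by rewrite big_ord_recr big_ord0 /= add0r subnn expr0 expr1n mulr1.
rewrite big_ord_recr /= subnn expr0 expr1n mulr1.
have -> : \sum_(k < j.+1) schur_weight r k * (r ^+ (j.+1 - k)) ^+ 2 =
   r ^+ 2 * \sum_(k < j.+1) schur_weight r k * (r ^+ (j - k)) ^+ 2.
  rewrite mulr_sumr; apply: eq_bigr => k _.
  by rewrite subSn -1?ltnS // [r ^+ (j - k).+1]exprS; ring.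
by rewrite IH mulr1 addrC subrK.
Qed.

(** Absorbs the k-th rank-one factor of the multiplier into the vectors; words shorter than k get
    the vector 0. *)
Let truncation H (r : R) (k : nat) (x : seq 'I_n * H) : seq 'I_n * H :=
  (x.1, ((k <= size x.1)%:R * r ^+ (size x.1 - k))%:C *: x.2).

Lemma poisson_scale H (X : 'I_n -> H -> H) (r : R) (N : nat) (s : seq (seq 'I_n * H)) :
  (forall i, linear (X i)) -> all (fun x => size x.1 <= N)%N s ->
  poisson (scale_tuple r X) s =
    \sum_(k < N.+1) schur_weight r k * poisson X (map (truncation r k) s).
Proof.
move=> lX /allP hN.
under [RHS]eq_bigr do rewrite /poisson big_map mulr_sumr.
rewrite exchange_big /= /poisson.
apply: eq_big_seq => x /hN xN.
under [RHS]eq_bigr do rewrite big_map mulr_sumr.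
rewrite exchange_big /=; apply: eq_bigr => y _.
under eq_bigr do rewrite poisson_termZ // -surjective_pairing -surjective_pairing mulrA.
rewrite -mulr_suml poisson_term_scale //.
have [yx|xy] := leqP (size y.1) (size x.1).
  by rewrite schur_weight_sum // yx.
(* The kernel identity is stated for j <= i only; in the other case both sides vanish. *)
have -> : poisson_term X x y = 0; last by rewrite !mulr0.
rewrite /poisson_term /toeplitz ifN; last by apply: contraL xy => /size_prefix; rewrite leqNgt.
by case: eqP xy => [->|_]; rewrite ?ltnn //= mul0r mulr0 subrr.
Qed.

Lemma all_size_bound H (s : seq (seq 'I_n * H)) :
  exists N, all (fun x => size x.1 <= N)%N s.
Proof.
elim: s => [|x s [N hN]]; first by exists 0%N.
exists (maxn (size x.1) N) => /=; rewrite leq_maxl /=.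
by apply: sub_all hN => y hy; rewrite (leq_trans hy) // leq_maxr.
Qed.

Lemma poisson_scale_le H (A B : 'I_n -> H -> H) (c r : R) :
  (forall i, linear (A i)) -> (forall i, linear (B i)) -> 0 <= r <= 1 ->
  (forall s, poisson A s <= c * poisson B s) ->
  forall s, poisson (scale_tuple r A) s <= c * poisson (scale_tuple r B) s.
Proof.
move=> lA lB /andP[r0 r1] h s.
have [N hN] := all_size_bound s.
rewrite !(poisson_scale _ _ hN) // mulr_sumr; apply: ler_sum => k _.
rewrite mulrCA ler_wpM2l //; case: (k : nat) => //= _.
by rewrite subr_ge0 exprn_ile1.
Qed.

(** For a fixed family both forms are polynomials in r, hence continuous at r = 1. *)
Lemma poisson_scale_lim H (A B : 'I_n -> H -> H) (c : R) (s : seq (seq 'I_n * H)) :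
  (forall i, linear (A i)) -> (forall i, linear (B i)) ->
  (forall r, 0 <= r < 1 -> poisson (scale_tuple r A) s <= c * poisson (scale_tuple r B) s) ->
  poisson A s <= c * poisson B s.
Proof.
move=> lA lB h.
pose P (X : 'I_n -> H -> H) : {poly R} :=
  \sum_(x <- s) \sum_(y <- s) (poisson_term X x y)%:P * 'X^(size x.1 - size y.1).
have PE X r : (forall i, linear (X i)) -> (P X).[r] = poisson (scale_tuple r X) s.
  move=> lX; rewrite horner_sum; apply: eq_bigr => x _; rewrite horner_sum.
  by apply: eq_bigr => y _; rewrite poisson_term_scale // hornerM hornerXn hornerC mulrC.
have P1 X : (P X).[1] = poisson X s.
  rewrite horner_sum; apply: eq_bigr => x _; rewrite horner_sum.
  by apply: eq_bigr => y _; rewrite hornerM hornerXn hornerC expr1n mulr1.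
pose D := c *: P B - P A.
suff : 0 <= D.[1] by rewrite /D hornerD hornerN hornerZ !P1 subr_ge0.
have cD : D.[r] @[r --> 1^'-] --> D.[1].
  by apply: cvg_at_left_filter; exact: continuous_horner.
apply: (cvgr_to_ge cD); near=> r.
rewrite /D hornerD hornerN hornerZ !PE // subr_ge0 h //; apply/andP; split.
  by near: r; apply: nbhs_left_ge.
by near: r; apply: nbhs_left_lt.
Unshelve. all: by end_near. Qed.

End Schur.

(** * Harnack domination *)

Section Harnack.
Context (R : realType) (n : nat).
Implicit Types H L : hilbertType R.

Section Polynomial.
Variables (m : nat) (w : 'I_m -> seq 'I_n).

(** Entry (i, j) of the polynomial is the monomial of v when w_j = w_i v. For the empty word the
    entries (i, j) and (j, i) both contribute to the real part, hence the 1/2. *)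
Let coef (v : seq 'I_n) : 'M[R[i]]_m :=
  \matrix_(i, j) (if w j == w i ++ v then (if v == [::] then 2^-1 else 1) else 0).

(* Its real part is half the Toeplitz matrix of the words [w i]. *)
Definition toeplitz_poly : nc_poly R n m :=
  [fsfun v in [fset x in [seq drop (size (w i)) (w j) | i <- enum 'I_m, j <- enum 'I_m]]%fset
    => coef v | 0].

Lemma toeplitz_polyE i j v : toeplitz_poly v i j =
  if w j == w i ++ v then (if v == [::] then 2^-1 else 1) else 0.
Proof.
rewrite fsfunE; case: ifPn => [_|vS]; first by rewrite mxE.
rewrite mxE; case: eqP => // wj; case/negP: vS.
rewrite inE; apply/allpairsP; exists (i, j) => /=.
by rewrite !mem_enum wj drop_size_cat.
Qed.

Lemma nc_eval_toeplitz H (X : 'I_n -> H -> H) i j a b :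
  <(nc_eval toeplitz_poly X i j a, b)> =
  (if w i == w j then 2^-1 else 1) * toeplitz X (w j, a) (w i, b).
Proof.
rewrite /nc_eval mxE sum_fctE inner_suml /toeplitz /=.
under eq_bigr do rewrite fctE innerZl toeplitz_polyE.
have [/prefixP[v0 wj]|npre] := boolP (prefix (w i) (w j)); last first.
  rewrite mulr0 big1 // => v _; case: eqP => [wj|_]; last by rewrite mul0r.
  by case/negP: npre; rewrite wj prefix_prefix.
have other v : v != v0 -> (w j == w i ++ v) = false.
  by apply: contraNF; rewrite wj eqseq_cat // eqxx /= => /eqP ->.
have -> : drop (size (w i)) (w j) = v0 by rewrite wj drop_size_cat.
have c0 : (if v0 == [::] then 2^-1 else 1 : R[i]) != 0.
  by case: ifP; rewrite ?oner_eq0 // invr_eq0 pnatr_eq0.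
have wE : (w i == w j) = (v0 == [::]).
  by rewrite wj -{1}(cats0 (w i)) eqseq_cat // eqxx /= eq_sym.
have v0in : v0 \in finsupp toeplitz_poly.
  rewrite mem_finsupp; apply/eqP => e0; move/eqP: c0; apply.
  by have := toeplitz_polyE i j v0; rewrite e0 wj eqxx mxE.
rewrite (bigD1_seq v0) ?fset_uniq //= big1 ?addr0 => [|v vv0].
  by rewrite wE {1}wj eqxx.
by rewrite other // mul0r.
Qed.

Lemma bounded_ops_nc_eval H (X : 'I_n -> H -> H) i j : (forall k, bounded_ops (X k)) ->
  bounded_ops (nc_eval toeplitz_poly X i j).
Proof.
move=> bX; rewrite mxE; apply: bounded_ops_sum => v _; apply: bounded_opsZ.
exact: bounded_ops_word_op.
Qed.

Lemma Re_toeplitz_poly H (X : 'I_n -> H -> H) (h : 'I_m -> H) :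
  (forall k, bounded_ops (X k)) ->
  \sum_(i < m) \sum_(j < m) <(Re_opmx (nc_eval toeplitz_poly X) i j (h j), h i)> =
  (2^-1 * \sum_(j < m) \sum_(i < m) poisson_term X (w j, h j) (w i, h i))%:C.
Proof.
move=> bX; pose z i j := <(nc_eval toeplitz_poly X i j (h j), h i)>.
have e i j : <(Re_opmx (nc_eval toeplitz_poly X) i j (h j), h i)> =
    2^-1 * z i j + 2^-1 * (z j i)^*%C.
  rewrite /Re_opmx mxE !fctE innerZl innerDl mulrDr; congr (_ + _ * _).
  rewrite adjointPl; last exact: bounded_ops_nc_eval.
  by rewrite innerC.
under eq_bigr do under eq_bigr do rewrite e.
under eq_bigr do rewrite big_split.
rewrite big_split /= [X in _ + X]exchange_big -big_split /=.
under eq_bigr do rewrite -big_split.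
rewrite exchange_big [in RHS]mulr_sumr rmorph_sum; apply: eq_bigr => j _.
rewrite mulr_sumr rmorph_sum; apply: eq_bigr => i _ /=.
rewrite -mulrDr addcJ mulKf ?pnatr_eq0 //; congr (_%:C).
rewrite /z nc_eval_toeplitz /poisson_term /= [w j == w i]eq_sym.
case: eqP => [wij|_]; last by rewrite !mul1r mul0r subr0; lra.
rewrite /toeplitz /= wij prefix_refl drop_size /= -/(rinner _ _).
have -> : (2^-1 : R[i]) = (2^-1)%:C by rewrite fmorphV rmorph_nat.
by rewrite -innerZl -/(rinner _ _) rinnerZl; lra.
Qed.

End Polynomial.

Lemma harnack_poisson L H (A B : 'I_n -> H -> H) (c : R) (s : seq (seq 'I_n * H)) :
  (forall i, bounded_ops (A i)) -> (forall i, bounded_ops (B i)) ->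
  harnack_dominated_by L c A B -> poisson A s <= c ^+ 2 * poisson B s.
Proof.
move=> bA bB dom.
pose t := tnth (in_tuple s); pose w i := (t i).1; pose h i := (t i).2.
have tE i : (w i, h i) = t i by rewrite /w /h -surjective_pairing.
have pE X : \sum_(j < size s) \sum_(i < size s) poisson_term X (w j, h j) (w i, h i) = poisson X s.
  rewrite /poisson [RHS]big_tnth; apply: eq_bigr => j _.
  by rewrite [RHS]big_tnth; apply: eq_bigr => i _; rewrite !tE.
(* [poisson_ge] holds on every Hilbert space, so it makes the polynomial an admissible test; the
   vectors of [s] are then inserted in the resulting inequality on H. *)
have pos (X : 'I_n -> L -> L) : open_row_ball X -> positive_opmx (Re_opmx (nc_eval (toeplitz_poly w) X)).
  move=> [bX X1] k; rewrite Re_toeplitz_poly // ler0c mulr_ge0 ?invr_ge0 //.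
  have cX : closed_row_ball X by split=> //; exact: ltW.
  have := poisson_ge [seq (w i, k i) | i <- enum 'I_(size s)] cX.
  rewrite /poisson big_map big_enum => /(le_trans (sqr_ge0 _)).
  by under eq_bigr do rewrite big_map big_enum.
have := dom _ _ pos h.
have -> : \sum_(i < size s) \sum_(j < size s)
    <((scale_opmx (c ^+ 2) (Re_opmx (nc_eval (toeplitz_poly w) B)) -
      Re_opmx (nc_eval (toeplitz_poly w) A)) i j (h j), h i)> =
   (c ^+ 2)%:C * \sum_(i < size s) \sum_(j < size s) <(Re_opmx (nc_eval (toeplitz_poly w) B) i j (h j), h i)>
   - \sum_(i < size s) \sum_(j < size s) <(Re_opmx (nc_eval (toeplitz_poly w) A) i j (h j), h i)>.
  rewrite mulr_sumr -sumrB; apply: eq_bigr => i _.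
  rewrite mulr_sumr -sumrB; apply: eq_bigr => j _.
  by rewrite /scale_opmx !mxE !fctE innerDl innerNl innerZl.
rewrite !Re_toeplitz_poly // !pE -rmorphM -rmorphB ler0c.
by lra.
Qed.

End Harnack.

(** * Operators on the tensor product with the Fock space *)

Section Tensor.
Context (R : realType) (n : nat) (H : hilbertType R) (F : fock_space R n)
        (HF : hilbert_tensor H F).

Lemma lincomb_approx (L : hilbertType R) I J (v : I -> L) (u : J -> L) :
  (forall j e, 0 < e -> exists l, hnorm (u j - lincomb v l) < e) ->
  forall l e, 0 < e -> exists l', hnorm (lincomb u l - lincomb v l') < e.
Proof.
move=> h; elim=> [|[a j] l IH] e e0.
  by exists [::]; rewrite /lincomb !big_nil subrr hnorm0.
have e2 : 0 < e / 2 by rewrite divr_gt0.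
have a0 : 0 <= complex.Re `|a| by rewrite -ler0c RRe_real ?ger0_real.
have a1 : 0 < complex.Re `|a| + 1 by rewrite ltr_pwDr.
have [l1 h1] := IH _ e2.
have [|l2 h2] := h j (e / 2 / (complex.Re `|a| + 1)); first by rewrite divr_gt0.
exists ([seq (a * p.1, p.2) | p <- l2] ++ l1).
rewrite lincombP {1}/lincomb big_cons -/(lincomb u l) /= opprD addrACA -scalerBr (splitr e).
apply: le_lt_trans (ler_hnormD _ _) _; apply: ler_ltD => //.
rewrite ltr_pdivlMr // in h2; rewrite hnormZC; apply: le_trans (ltW h2).
by rewrite mulrC ler_wpM2l ?hnorm_ge0 // lerDl.
Qed.

Lemma hnorm_tensor h f : hnorm (tensor HF h f) = hnorm h * hnorm f.
Proof.
have : hnorm (tensor HF h f) ^+ 2 = (hnorm h * hnorm f) ^+ 2.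
  apply: (@complexI R); rewrite -inner_xx tensor_inner !inner_xx.
  by rewrite exprMn -rmorphM.
by move/(congr1 Num.sqrt); rewrite !sqrtr_sqr !ger0_norm ?mulr_ge0 ?hnorm_ge0.
Qed.

Lemma bounded_ops_tensorr h : bounded_ops (tensor HF h).
Proof.
apply: (@bounded_opsI _ _ _ _ (hnorm h)); first exact: tensor_linearr.
by move=> f; rewrite hnorm_tensor.
Qed.

Definition fock_tensor (x : seq 'I_n * H) : HF := tensor HF x.2 (fock_basis F x.1).

Definition fock_tensor_sum (s : seq (seq 'I_n * H)) : HF := \sum_(x <- s) fock_tensor x.

Lemma inner_fock_tensor x y :
  <(fock_tensor x, fock_tensor y)> = (x.1 == y.1)%:R * <(x.2, y.2)>.
Proof. by rewrite tensor_inner fock_orthonormal mulrC. Qed.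

(** Scalars are absorbed into the H factor, so combinations become families of pairs (word, vector),
    the arguments of [poisson]. *)
Lemma lincomb_fock_tensor (S : H -> H) (sg : seq 'I_n -> seq 'I_n) l : linear S ->
  lincomb (fun x => tensor HF (S x.2) (fock_basis F (sg x.1))) l =
  \sum_(x <- [seq (p.2.1, p.1 *: p.2.2) | p <- l]) tensor HF (S x.2) (fock_basis F (sg x.1)).
Proof.
move=> lS; rewrite /lincomb big_map; apply: eq_bigr => -[a [w h]] _ /=.
rewrite (linZ lS); apply/esym; exact: (linZ (tensor_linearl HF (fock_basis F (sg w)))).
Qed.

Lemma total_fock_tensor : total_family fock_tensor.
Proof.
apply: approx_total => x e e0.
have e2 : 0 < e / 2 by rewrite divr_gt0.
have [l hl] := total_approx (tensor_total HF) x e2.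
have [|l' hl'] := @lincomb_approx HF _ _ fock_tensor (fun hf : H * F => tensor HF hf.1 hf.2) _ l _ e2.
  move=> [h f] d d0 /=; have h1 : 0 < hnorm h + 1 by rewrite ltr_pwDr ?hnorm_ge0.
  have [|m hm] := total_approx (fock_total F) f (e := d / (hnorm h + 1)); first by rewrite divr_gt0.
  exists [seq (p.1, (p.2, h)) | p <- m].
  have -> : lincomb fock_tensor [seq (p.1, (p.2, h)) | p <- m] = tensor HF h (lincomb (fock_basis F) m).
    rewrite (lin_lincomb _ _ (tensor_linearr HF h)).
    by rewrite /lincomb big_map.
  rewrite -(linB (tensor_linearr HF h)) hnorm_tensor.
  rewrite ltr_pdivlMr // in hm; apply: le_lt_trans hm.
  by rewrite mulrC ler_wpM2l ?hnorm_ge0 // lerDl.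
exists l'.
  rewrite (splitr e); apply: le_lt_trans (hnorm_triangle _ (lincomb (fun hf : H * F => tensor HF hf.1 hf.2) l) _) _.
  exact: ltrD.
exists [seq (p.2.1, p.1 *: p.2.2) | p <- l'], (fun=> 1).
rewrite (lincomb_fock_tensor (S := id) id l') //.
by apply: eq_bigr => x' _; rewrite scale1r.
Qed.

Lemma big_group (V : nmodType) (s : seq (seq 'I_n * H)) (f : seq 'I_n * H -> V) :
  \sum_(x <- s) f x = \sum_(w <- undup (map fst s)) \sum_(x <- s | x.1 == w) f x.
Proof.
under [RHS]eq_bigr do rewrite big_mkcond.
rewrite exchange_big /=; apply: eq_big_seq => x xs.
rewrite (bigD1_seq x.1) ?undup_uniq //=; last by rewrite mem_undup map_f.
rewrite eqxx big1 ?addr0 // => w wx.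
by rewrite eq_sym (negbTE wx).
Qed.

Lemma hnorm_fock_sum (W : seq (seq 'I_n)) (sg : seq 'I_n -> seq 'I_n) (a : seq 'I_n -> H) :
  injective sg -> uniq W ->
  hnorm (\sum_(w <- W) tensor HF (a w) (fock_basis F (sg w))) ^+ 2 = \sum_(w <- W) hnorm (a w) ^+ 2.
Proof.
move=> isg uW; rewrite sqr_hnorm_sum; apply: eq_big_seq => w wW.
rewrite (bigD1_seq w) //= big1 ?addr0 => [|v vw].
  by rewrite tensor_inner fock_orthonormal eqxx mulr1 hnorm_sqr.
by rewrite tensor_inner fock_orthonormal (inj_eq isg) eq_sym (negbTE vw) mulr0.
Qed.

(** A family may repeat a word, so vectors with the same word are first added up; Pythagoras then
    applies on both sides, as an injective [sg] preserves orthogonality. *)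
Lemma fock_tensor_le (S : H -> H) (sg : seq 'I_n -> seq 'I_n) (c : R) s :
  linear S -> hbounded S c -> 0 <= c -> injective sg ->
  hnorm (\sum_(x <- s) tensor HF (S x.2) (fock_basis F (sg x.1)))
    <= c * hnorm (fock_tensor_sum s).
Proof.
move=> lS bS c0 isg; apply: le_of_sqr; first by rewrite mulr_ge0 ?hnorm_ge0.
pose g w := \sum_(x <- s | x.1 == w) x.2.
have regroup (T : H -> H) (tau : seq 'I_n -> seq 'I_n) : linear T ->
    \sum_(x <- s) tensor HF (T x.2) (fock_basis F (tau x.1)) =
    \sum_(w <- undup (map fst s)) tensor HF (T (g w)) (fock_basis F (tau w)).
  move=> lT; rewrite big_group; apply: eq_bigr => w _.
  rewrite (lin_sum lT)  (lin_sum (tensor_linearl HF (fock_basis F (tau w)))).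
  by apply: eq_bigr => x /eqP ->.
rewrite regroup // /fock_tensor_sum (regroup id id) // exprMn.
rewrite !hnorm_fock_sum ?undup_uniq // mulr_sumr; apply: ler_sum => w _.
by rewrite -exprMn ler_sqr ?nnegrE ?mulr_ge0 ?hnorm_ge0.
Qed.

Lemma total_fock_eq (S T : HF -> HF) : bounded_ops S -> bounded_ops T ->
  (forall x, S (fock_tensor x) = T (fock_tensor x)) -> S = T.
Proof. exact: total_eq total_fock_tensor. Qed.

(** Restricted to operators [T] that move basis words injectively, which covers the identity and the
    right creations. *)
Lemma tensor_op_spec (S : H -> H) (T : F -> F) (sg : seq 'I_n -> seq 'I_n) (c : R) :
  bounded_ops S -> hbounded S c -> 0 <= c -> injective sg ->
  bounded_ops T -> (forall w, T (fock_basis F w) = fock_basis F (sg w)) ->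
  [/\ bounded_ops (tensor_op HF S T), hbounded (tensor_op HF S T) c
    & forall h f, tensor_op HF S T (tensor HF h f) = tensor HF (S h) (T f)].
Proof.
move=> [lS cS] bS c0 isg bT Tsg.
have [l|U [lU bU Ue]] := @bounded_extension _ _ HF _ fock_tensor
    (fun x => tensor HF (S x.2) (fock_basis F (sg x.1))) c total_fock_tensor c0.
  rewrite lincomb_fock_tensor // [X in c * hnorm X](lincomb_fock_tensor (S := id) id l) //.
  exact: fock_tensor_le.
have bU' : bounded_ops U by exact: bounded_opsI bU.
have Uhf h f : U (tensor HF h f) = tensor HF (S h) (T f).
  suff : U \o tensor HF h = tensor HF (S h) \o T by move/(congr1 (@^~ f)).
  apply: (total_eq (fock_total F)).
  - by apply: bounded_ops_comp => //; exact: bounded_ops_tensorr.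
  - by apply: bounded_ops_comp => //; exact: bounded_ops_tensorr.
  - by move=> w /=; rewrite Tsg (Ue (w, h)).
have [b e] : bounded_ops (tensor_op HF S T) /\
    forall h f, tensor_op HF S T (tensor HF h f) = tensor HF (S h) (T f).
  apply: (@xgetPex _ _ [set U0 | bounded_ops U0 /\
    forall h f, U0 (tensor HF h f) = tensor HF (S h) (T f)]).
  by exists U.
split=> //; suff -> : tensor_op HF S T = U by [].
by apply: total_fock_eq => // x; rewrite /fock_tensor e Uhf.
Qed.

Lemma right_creation_spec i : bounded_ops (right_creation (F := F) i) /\
  forall w, right_creation (F := F) i (fock_basis F w) = fock_basis F (rcons w i).
Proof.
apply: (@xgetPex _ _ [set U | bounded_ops U /\
    forall w, U (fock_basis F w) = fock_basis F (rcons w i)]).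
have [l|U [lU bU Ue]] := @bounded_extension _ _ F _ (fock_basis F)
    (fun w => fock_basis F (rcons w i)) 1 (fock_total F) ler01.
  rewrite mul1r; apply: le_of_sqr; first exact: hnorm_ge0.
  rewrite /lincomb !sqr_hnorm_sum le_eqVlt; apply/orP; left; apply/eqP.
  apply: eq_bigr => p _; apply: eq_bigr => q _; rewrite !innerZl !innerZr !fock_orthonormal.
  by rewrite (inj_eq (@rcons_injl _ i)).
by exists U; split=> //; exact: bounded_opsI bU.
Qed.

End Tensor.

(** * The reconstruction operator and [C_op] *)

Section Reconstruction.
Context (R : realType) (n : nat) (H : hilbertType R) (F : fock_space R n)
        (HF : hilbert_tensor H F) (A : 'I_n -> H -> H).
Hypothesis A_ball : open_row_ball A.

Let bA i : bounded_ops (A i). Proof. by case: A_ball. Qed.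
Let bA' i : bounded_ops (adjoint (A i)). Proof. exact: bounded_ops_adjoint. Qed.

Let et := fock_tensor HF.
Let Rec := reconstruction_op (HF := HF) A.
Let Def := tensor_op HF (defect_op A) id.
Let Sq := row_square A.
Let q := row_norm A ^+ 2.
Let SqI := tensor_op HF Sq id.

Let bSq : bounded_ops Sq. Proof. exact: bounded_ops_row_square. Qed.
Let qSq : hbounded Sq q. Proof. by rewrite /q row_norm_sqr //; exact: opnormP. Qed.
Let rn0 : 0 <= row_norm A. Proof. exact: sqrtr_ge0. Qed.
Let rn1 : row_norm A < 1. Proof. by case: A_ball. Qed.
Let q01 : 0 <= q < 1. Proof. by rewrite sqr_ge0 expr_lt1. Qed.

Let defect_spec : [/\ bounded_ops (defect_op A), positive_op (defect_op A)
  & defect_op A \o defect_op A = id - Sq].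
Proof. by apply: (sqrt_op_spec (q := q)) => // x y; exact: row_square_sym. Qed.

Let defect_sym x y : <(defect_op A x, y)> = <(x, defect_op A y)>.
Proof. by case: defect_spec => [[lD _] pD _]; exact: positive_op_sym. Qed.

Let Def_spec : bounded_ops Def /\ forall h f, Def (tensor HF h f) = tensor HF (defect_op A h) f.
Proof.
have [bD _ _] := defect_spec; have [_ [c c0 hD]] := bounded_opsE bD.
by have [b _ e] := tensor_op_spec HF bD hD c0 (@inj_id _) (bounded_ops_id F) (fun=> erefl).
Qed.

Let SqI_spec : [/\ bounded_ops SqI, hbounded SqI q
  & forall h f, SqI (tensor HF h f) = tensor HF (Sq h) f].
Proof. exact: (tensor_op_spec HF bSq qSq (sqr_ge0 _) (@inj_id _) (bounded_ops_id F) (fun=> erefl)). Qed.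

Let Rec_term i : bounded_ops (tensor_op HF (adjoint (A i)) (right_creation (F := F) i)) /\
  forall h f, tensor_op HF (adjoint (A i)) (right_creation (F := F) i) (tensor HF h f) =
    tensor HF (adjoint (A i) h) (right_creation i f).
Proof.
have [_ [c c0 hA]] := bounded_opsE (bA' i); have [b e] := right_creation_spec F i.
by have [] := tensor_op_spec HF (bA' i) hA c0 (@rcons_injl _ i) b e.
Qed.

Let bRec : bounded_ops Rec.
Proof. by apply: bounded_ops_sum => i _; case: (Rec_term i). Qed.

Let Rec_et x : Rec (et x) = \sum_(i < n) et (rcons x.1 i, adjoint (A i) x.2).
Proof.
rewrite /Rec /reconstruction_op sum_fctE; apply: eq_bigr => i _.
by have [_ ->] := Rec_term i; have [_ ->] := right_creation_spec F i.
Qed.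

Let adj_Rec0 b : adjoint Rec (et ([::], b)) = 0.
Proof.
apply: (total_inner (total_fock_tensor HF)) => y.
rewrite adjointPl // Rec_et inner_sumr inner0l big1 // => i _.
by rewrite inner_fock_tensor /=; case: (y.1) => [|? ?]; rewrite mul0r.
Qed.

(** Right creation appends a letter, so only the i-th summand of [Rec] reaches words ending in i. *)
Let adj_Rec w i b : adjoint Rec (et (rcons w i, b)) = et (w, A i b).
Proof.
apply: (total_inner (total_fock_tensor HF)) => y.
rewrite adjointPl // Rec_et inner_sumr (bigD1 i) //= big1 ?addr0 => [|j ji].
  by rewrite !inner_fock_tensor /= eqseq_rcons eqxx andbT adjointP.
by rewrite inner_fock_tensor /= eqseq_rcons [i == j]eq_sym (negbTE ji) andbF mul0r.
Qed.

Let adj_Rec_Rec : adjoint Rec \o Rec = SqI.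
Proof.
have [bS _ eS] := SqI_spec.
apply: (total_fock_eq (HF := HF)) => // [|x].
  by apply: bounded_ops_comp => //; exact: bounded_ops_adjoint.
rewrite /= Rec_et (lin_sum (bounded_ops_lin (bounded_ops_adjoint bRec))).
under eq_bigr do rewrite adj_Rec.
rewrite /et {2}/fock_tensor eS /Sq /row_square sum_fctE.
by rewrite (lin_sum (tensor_linearl HF _)).
Qed.

Let adj_Def : adjoint Def = Def.
Proof.
have [bD eD] := Def_spec.
apply: (total_fock_eq (HF := HF)) => // [|x]; first exact: bounded_ops_adjoint.
apply: (total_inner (total_fock_tensor HF)) => y.
by rewrite adjointPl // {2 3}/fock_tensor !eD !tensor_inner defect_sym.
Qed.

Let Def_Def : Def \o Def = id - SqI.
Proof.
have [bD eD] := Def_spec; have [bS _ eS] := SqI_spec.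
apply: (total_fock_eq (HF := HF)) => [||x].
- exact: bounded_ops_comp.
- by apply: bounded_opsB => //; exact: bounded_ops_id.
rewrite /= !fctE /= /fock_tensor !eD eS -(linB (tensor_linearl HF _)) /=.
by have [_ _ /(congr1 (@^~ x.2)) /= ->] := defect_spec.
Qed.

Let Rec_sqr x : hnorm (Rec x) ^+ 2 = rinner (SqI x) x.
Proof. by rewrite hnorm_sqr -adj_Rec_Rec /rinner /= adjointPl. Qed.

Let Def_sqr x : hnorm (Def x) ^+ 2 = hnorm x ^+ 2 - hnorm (Rec x) ^+ 2.
Proof.
have [bD _] := Def_spec.
rewrite Rec_sqr [LHS]hnorm_sqr [X in X - _]hnorm_sqr -rinnerNl -rinnerDl.
rewrite /rinner -{2}adj_Def -adjointP //; congr (complex.Re <(_, x)>).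
by move/(congr1 (@^~ x)): Def_Def.
Qed.

Let Rec_bound : hbounded Rec (row_norm A).
Proof.
move=> x; apply: le_of_sqr; first by rewrite mulr_ge0 ?hnorm_ge0.
rewrite Rec_sqr exprMn; apply: le_trans (rinner_le _ _) _.
have [_ hS _] := SqI_spec.
by rewrite [hnorm x ^+ 2]expr2 mulrA ler_wpM2r ?hnorm_ge0.
Qed.

Let G := inv_op (id - Rec).

Let G_spec : [/\ bounded_ops G, G \o (id - Rec) = id & (id - Rec) \o G = id].
Proof. by apply: inv_op_neumann Rec_bound _ => //; rewrite rn0. Qed.

Let GE x : G x - Rec (G x) = x.
Proof. by have [_ _ /(congr1 (@^~ x))] := G_spec. Qed.

Lemma bounded_ops_C_op : bounded_ops (C_op HF A).
Proof. by have [bG _ _] := G_spec; have [bD _] := Def_spec; exact: bounded_ops_comp. Qed.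

Lemma C_op_spec :
  [/\ bounded_ops (inv_op (C_op HF A)), inv_op (C_op HF A) \o C_op HF A = id
    & C_op HF A \o inv_op (C_op HF A) = id].
Proof.
have /andP[q0 q1] := q01.
have [bG GI _] := G_spec; have [bD _] := Def_spec; have [bS hS _] := SqI_spec.
have p0 : 0 < Num.sqrt (1 - q) by rewrite sqrtr_gt0 subr_gt0.
have D_lb x : Num.sqrt (1 - q) * hnorm x <= hnorm (Def x).
  apply: le_of_sqr; first exact: hnorm_ge0.
  rewrite exprMn sqr_sqrtr ?subr_ge0 ?(ltW q1) // Def_sqr mulrBl mul1r lerD2l lerN2.
  by rewrite /q -exprMn ler_sqr ?nnegrE ?mulr_ge0 ?hnorm_ge0.
(* x = G x - R G x with R a contraction, so |x| <= 2 |G x|. *)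
have G_lb x : 2^-1 * hnorm x <= hnorm (G x).
  have := ler_hnormD (G x) (- Rec (G x)); rewrite GE hnorm_opp.
  have := Rec_bound (G x); have := hnorm_ge0 (G x).
  have : row_norm A * hnorm (G x) <= 1 * hnorm (G x) by rewrite ler_wpM2r ?hnorm_ge0 // ltW.
  lra.
apply: (inv_op_spec (c := Num.sqrt (1 - q) * 2^-1)) => [|||y].
- exact: bounded_ops_C_op.
- by rewrite mulr_gt0 ?invr_gt0.
- move=> x; rewrite -mulrA; apply: le_trans (D_lb _).
  by rewrite ler_wpM2l // ltW.
- have [_ /(_ y)[x xy]] := neumann (bounded_ops_lin bS) hS q01.
  (* [C_op] sends this vector to Def (Def x) = x - SqI x = y, where x solves the last equation by
     the Neumann series. *)
  exists ((id - Rec) (Def x)).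
  have -> : C_op HF A ((id - Rec) (Def x)) = Def ((G \o (id - Rec)) (Def x)) by [].
  by rewrite GI /= -xy -Def_Def.
Qed.

(** A prefix of w i is either the whole word or a prefix of w; in the latter case the letter i acts
    first on b. *)
Lemma toeplitz_rcons (X : 'I_n -> H -> H) w i b (x : seq 'I_n * H) :
  toeplitz X (rcons w i, b) x = (rcons w i == x.1)%:R * <(b, x.2)> + toeplitz X (w, X i b) x.
Proof.
rewrite /toeplitz /=.
have [/prefixP[v wv]|np] := boolP (prefix x.1 w).
  have -> : (rcons w i == x.1) = false.
    by apply/negP => /eqP/(congr1 size); rewrite wv size_rcons size_cat -addnS; move/eqP; rewrite -[X in _ == X]addn0 eqn_add2l.
  rewrite mul0r add0r wv rcons_cat prefix_prefix !drop_size_cat //.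
  by rewrite -cats1 word_op_cat.
rewrite addr0; case: eqP => [<-|ne]; first by rewrite prefix_refl drop_size mul1r.
rewrite ifN ?mul0r //; apply: contra np => /prefixP[v].
case/lastP: v => [|v j]; first by rewrite cats0 => /ne.
by rewrite -rcons_cat => /rcons_inj[-> _]; rewrite prefix_prefix.
Qed.

(** With g = h + R g, moving R to the other side strips the last letter of the word: the recursion
    of [toeplitz_rcons], conjugated. *)
Let inner_G s y : <(G (fock_tensor_sum HF s), et y)> = \sum_(x <- s) (toeplitz A y x)^*%C.
Proof.
case: y => w b; set g := G _.
have gE : g = fock_tensor_sum HF s + Rec g.
  by have := GE (fock_tensor_sum HF s); rewrite -/g => {1}<-; rewrite subrK.
have sumE v c : <(fock_tensor_sum HF s, et (v, c))> =
    \sum_(x <- s) ((v == x.1)%:R * <(c, x.2)>)^*%C.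
  rewrite /fock_tensor_sum inner_suml; apply: eq_bigr => x _.
  by rewrite innerC inner_fock_tensor.
elim/last_ind: w b => [|w i IH] b; rewrite gE innerDl sumE adjointP //.
  rewrite adj_Rec0 inner0r addr0; apply: eq_bigr => x _; congr (_^*%C).
  rewrite /toeplitz /=; case: (x.1) => [|j v] /=; last by rewrite mul0r.
  by rewrite mul1r.
rewrite adj_Rec IH -big_split; apply: eq_bigr => x _ /=.
by rewrite toeplitz_rcons rmorphD.
Qed.

Lemma C_op_poisson s : hnorm (C_op HF A (fock_tensor_sum HF s)) ^+ 2 = poisson A s.
Proof.
set x := fock_tensor_sum HF s.
have -> : C_op HF A x = Def (G x) by [].
have RG : Rec (G x) = G x - x by rewrite -[X in _ - X]GE opprB addrC subrK.
rewrite Def_sqr RG hnormB_sqr.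
have -> : hnorm (G x) ^+ 2 - (hnorm (G x) ^+ 2 - 2 * rinner (G x) x + hnorm x ^+ 2)
  = 2 * rinner (G x) x - hnorm x ^+ 2 by ring.
have -> : rinner (G x) x = \sum_(z <- s) \sum_(y <- s) complex.Re (toeplitz A z y).
  rewrite {2}/x rinner_sumr; apply: eq_bigr => z _.
  rewrite /rinner inner_G raddf_sum; apply: eq_bigr => y _ /=.
  by case: (toeplitz A z y).
rewrite /x sqr_hnorm_sum mulr_sumr -sumrB; apply: eq_bigr => z _.
rewrite mulr_sumr -sumrB; apply: eq_bigr => y _.
rewrite /poisson_term inner_fock_tensor; congr (_ - _).
by case: (_ == _); rewrite ?mul1r ?mul0r.
Qed.

End Reconstruction.

(** * The intertwiner *)

Section Intertwiner.
Context (R : realType) (n : nat) (H KA KB : hilbertType R).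
Variables (A B : 'I_n -> H -> H) (JA : H -> KA) (V : 'I_n -> KA -> KA)
  (JB : H -> KB) (W : 'I_n -> KB -> KB).
Hypotheses (dilA : minimal_isometric_dilation A JA V)
  (dilB : minimal_isometric_dilation B JB W)
  (bA : forall i, bounded_ops (A i)) (bB : forall i, bounded_ops (B i)).

Let L := dilation_intertwiner JB W JA V.

Lemma lincomb_dilation (K : hilbertType R) (J : H -> K) (U : 'I_n -> K -> K) l :
  linear J -> (forall i, linear (U i)) ->
  lincomb (fun x : seq 'I_n * H => word_op U x.1 (J x.2)) l =
  \sum_(x <- [seq (p.2.1, p.1 *: p.2.2) | p <- l]) word_op U x.1 (J x.2).
Proof.
move=> lJ lU; rewrite /lincomb big_map; apply: eq_bigr => p _ /=.
by rewrite (linZ lJ) (linZ (linear_word_op _ lU)).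
Qed.

Let bJA : bounded_ops JA. Proof. by have [] := mid_incl dilA. Qed.
Let bJB : bounded_ops JB. Proof. by have [] := mid_incl dilB. Qed.
Let lJA : linear JA. Proof. by case: bJA. Qed.
Let lJB : linear JB. Proof. by case: bJB. Qed.
Let bV i : bounded_ops (V i). Proof. by case: (mid_isom dilA i). Qed.
Let bW i : bounded_ops (W i). Proof. by case: (mid_isom dilB i). Qed.
Let lV i : linear (V i). Proof. by case: (bV i). Qed.
Let lW i : linear (W i). Proof. by case: (bW i). Qed.

Let hnorm_le s (c : R) : 0 <= c ->
  (poisson A s <= c ^+ 2 * poisson B s) <->
  (hnorm (\sum_(x <- s) word_op V x.1 (JA x.2)) <= c * hnorm (\sum_(x <- s) word_op W x.1 (JB x.2))).
Proof.
move=> c0; rewrite -(dilation_poisson dilA bA) -(dilation_poisson dilB bB) -exprMn.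
by rewrite ler_sqr ?nnegrE ?mulr_ge0 ?hnorm_ge0.
Qed.

(** The inequality is exactly what makes W_w h |-> V_w h extend boundedly; the intertwining relation
    holds on the total family W_w h, hence everywhere. *)
Lemma dilation_intertwiner_spec (c : R) : 0 <= c ->
  (forall s, poisson A s <= c ^+ 2 * poisson B s) ->
  bounded_ops L /\ forall x, L (word_op W x.1 (JB x.2)) = word_op V x.1 (JA x.2).
Proof.
move=> c0 h.
have [b e1 e2] : [/\ bounded_ops L, (forall h, L (JB h) = JA h) & forall i k, L (W i k) = V i (L k)].
  apply: (@xgetPex _ _ [set L | [/\ bounded_ops L, (forall h, L (JB h) = JA h)
                    & forall i k, L (W i k) = V i (L k)]]).
  have [l|T [lT bT Te]] := @bounded_extension _ KB KA _
      (fun x : seq 'I_n * H => word_op W x.1 (JB x.2)) (fun x => word_op V x.1 (JA x.2)) c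
      (mid_min dilB) c0.
    rewrite !lincomb_dilation //.
    exact/hnorm_le.
  have bT' : bounded_ops T by exact: bounded_opsI bT.
  exists T; split=> // [x|i k]; first exact: (Te ([::], x)).
  suff : T \o W i = V i \o T by move/(congr1 (@^~ k)).
  apply: (total_eq (mid_min dilB)) => [||x]; [exact: bounded_ops_comp..|].
  by rewrite /= Te (Te (i :: x.1, x.2)).
split=> // -[w x] /=; elim: w => [|i w IH] /=; first exact: e1.
by rewrite e2 IH.
Qed.

(** [c] guarantees that the operator exists, [d] is the bound under test. The admissible d are
    described by the Poisson forms alone. *)
Lemma opnorm_dilation_intertwiner (c d : R) : 0 <= c ->
  (forall s, poisson A s <= c ^+ 2 * poisson B s) -> 0 <= d ->
  (opnorm L <= d) <-> (forall s, poisson A s <= d ^+ 2 * poisson B s).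
Proof.
move=> c0 /(dilation_intertwiner_spec c0)[bL Le] d0; split=> [Ld s|h].
  apply/(hnorm_le _ d0).
  under eq_bigr do rewrite -Le.
  rewrite -(lin_sum (bounded_ops_lin bL)).
  by apply: le_trans (opnormP bL _) _; rewrite ler_wpM2r ?hnorm_ge0.
apply: opnorm_le => //.
apply: (hbounded_total (T := id) (mid_min dilB) bL (bounded_ops_id KB) d0) => l.
rewrite (lin_lincomb _ _ (bounded_ops_lin bL)) lincomb_dilation //.
have -> : lincomb (L \o (fun x : seq 'I_n * H => word_op W x.1 (JB x.2))) l =
    lincomb (fun x : seq 'I_n * H => word_op V x.1 (JA x.2)) l.
  by apply: eq_bigr => p _ /=; rewrite Le.
rewrite lincomb_dilation //.
exact/hnorm_le.
Qed.

End Intertwiner.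

(** * The quotient of two [C_op] operators and the norm formulas *)

Section ComparisonOfC.
Context (R : realType) (n : nat) (H : hilbertType R) (F : fock_space R n)
        (HF : hilbert_tensor H F) (A B : 'I_n -> H -> H).
Hypotheses (A_ball : open_row_ball A) (B_ball : open_row_ball B).

Lemma bounded_ops_C_quotient : bounded_ops (C_op HF A \o inv_op (C_op HF B)).
Proof.
have [b _ _] := C_op_spec HF B_ball.
by apply: bounded_ops_comp => //; exact: bounded_ops_C_op.
Qed.

Lemma opnorm_C_quotient (d : R) : 0 <= d ->
  (opnorm (C_op HF A \o inv_op (C_op HF B)) <= d) <->
  (forall s, poisson A s <= d ^+ 2 * poisson B s).
Proof.
move=> d0; have [bI IB BI] := C_op_spec HF B_ball.
have cmp s : (poisson A s <= d ^+ 2 * poisson B s) <->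
    (hnorm (C_op HF A (fock_tensor_sum HF s)) <= d * hnorm (C_op HF B (fock_tensor_sum HF s))).
  rewrite -(C_op_poisson HF A_ball) -(C_op_poisson HF B_ball) -exprMn.
  by rewrite ler_sqr ?nnegrE ?mulr_ge0 ?hnorm_ge0.
split=> [Ld s|h].
  apply/cmp; set x := fock_tensor_sum HF s.
  have -> : C_op HF A x = (C_op HF A \o inv_op (C_op HF B)) (C_op HF B x).
    by rewrite /=; congr (C_op HF A _); move/(congr1 (@^~ x)): IB.
  apply: le_trans (opnormP bounded_ops_C_quotient _) _.
  by rewrite ler_wpM2r ?hnorm_ge0.
apply: opnorm_le => // y.
(* With x the preimage of y under C_B, the claim becomes |C_A x| <= d |C_B x|, which may be checked
   on finite families. *)
have -> : hnorm y = hnorm (C_op HF B (inv_op (C_op HF B) y)).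
  by congr hnorm; move/(congr1 (@^~ y)): BI.
apply: (hbounded_total (total_fock_tensor HF) (bounded_ops_C_op HF A_ball) (bounded_ops_C_op HF B_ball) d0) => l.
by rewrite !(lincomb_fock_tensor HF (S := id) id l) //; apply/cmp.
Qed.

End ComparisonOfC.

Lemma scale_tuple_open_ball (R : realType) (n : nat) (H : hilbertType R)
    (A : 'I_n -> H -> H) (r : R) :
  closed_row_ball A -> 0 <= r < 1 -> open_row_ball (scale_tuple r A).
Proof.
move=> [bA A1] /andP[r0 r1].
have brA i : bounded_ops (scale_tuple r A i) by exact: bounded_opsZ.
split=> //; apply: le_lt_trans r1; apply: le_of_sqr => //.
have adj i : adjoint (scale_tuple r A i) = r%:C *: adjoint (A i).
  apply: adjoint_eq => // x y.
  by rewrite /scale_tuple !fctE innerZl innerZr adjointP // conjc_real.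
rewrite row_norm_sqr //; apply: opnorm_le => [|x]; first exact: sqr_ge0.
have -> : row_square (scale_tuple r A) x = (r ^+ 2)%:C *: row_square A x.
  rewrite /row_square !sum_fctE scaler_sumr; apply: eq_bigr => i _ /=.
  rewrite adj {1}/scale_tuple !fctE linZ ?scalerA -?rmorphM //.
  by case: (bA i).
rewrite hnormZ ger0_norm ?sqr_ge0 // ler_wpM2l ?sqr_ge0 //.
apply: le_trans (opnormP (bounded_ops_row_square bA) x) _.
by rewrite -row_norm_sqr // ler_piMl ?hnorm_ge0 // exprn_ile1 // sqrtr_ge0.
Qed.

Theorem theorem4p4 (R : realType) (n : nat) (n_gt0 : (0 < n)%N)
    (H : hilbertType R)
    (K : hilbertType R) (K_infinite : infinite_dimensional K)
    (F : fock_space R n) (HF : hilbert_tensor H F)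
    (A B : 'I_n -> H -> H)
    (KA KB : hilbertType R)
    (JA : H -> KA) (V : 'I_n -> KA -> KA)
    (JB : H -> KB) (W : 'I_n -> KB -> KB)
    (dilA : minimal_isometric_dilation A JA V)
    (dilB : minimal_isometric_dilation B JB W) :
  (open_row_ball A -> open_row_ball B ->
     opnorm (dilation_intertwiner JB W JA V)
     = opnorm (C_op HF A \o inv_op (C_op HF B)))
  /\
  (closed_row_ball A -> closed_row_ball B -> harnack_dominated K A B ->
     (opnorm (dilation_intertwiner JB W JA V))%:E
     = ereal_sup [set (opnorm (C_op HF (scale_tuple r A)
                               \o inv_op (C_op HF (scale_tuple r B))))%:E
                 | r in [set r : R | 0 <= r < 1]]).
Proof.
split=> [oA oB|cA cB [c c0 dom]].
  have bC := bounded_ops_C_quotient HF oA oB.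
  have C0 := opnorm_ge0 bC.
  have [bA _] := oA; have [bB _] := oB.
  (* The norm of the quotient, tested against itself, provides the constant that makes the
     intertwiner exist. *)
  have hC := (opnorm_C_quotient HF oA oB C0).1 (lexx _).
  have iff d := opnorm_dilation_intertwiner dilA dilB bA bB (d := d) C0 hC.
  have [bL _] := dilation_intertwiner_spec dilA dilB bA bB C0 hC.
  apply/le_anti/andP; split; first exact/(iff _ C0).
  have L0 := opnorm_ge0 bL.
  by apply/(opnorm_C_quotient HF oA oB L0)/(iff _ L0).
have [bA _] := cA; have [bB _] := cB.
have lA i : linear (A i) by case: (bA i).
have lB i : linear (B i) by case: (bB i).
have hAB s : poisson A s <= c ^+ 2 * poisson B s by exact: harnack_poisson dom.
have iff d := opnorm_dilation_intertwiner dilA dilB bA bB (d := d) (ltW c0) hAB.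
have [bL _] := dilation_intertwiner_spec dilA dilB bA bB (ltW c0) hAB.
have L0 := opnorm_ge0 bL.
set S := [set _ | _ in _].
have le_L : (ereal_sup S <= (opnorm (dilation_intertwiner JB W JA V))%:E)%E.
  apply: ge_ereal_sup => _ [r /= r01 <-]; rewrite lee_fin.
  apply/opnorm_C_quotient => //; try exact: scale_tuple_open_ball.
  apply: poisson_scale_le => //; first by case/andP: r01 => -> /ltW.
  exact/iff.
have S_ub r : 0 <= r < 1 -> ((opnorm (C_op HF (scale_tuple r A)
    \o inv_op (C_op HF (scale_tuple r B))))%:E <= ereal_sup S)%E.
  by move=> r01; apply: ereal_sup_ubound; exists r.
have r0 : 0 <= (0 : R) < 1 by rewrite lexx ltr01.
apply/le_anti/andP; split=> //.
(* Only a finite supremum needs an argument: r = 0 is admissible, which excludes minus infinity. *)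
case: (ereal_sup S) le_L S_ub => [m _ S_ub| |_ /(_ _ r0)] //.
have m0 : 0 <= m.
  rewrite -lee_fin; apply: le_trans (S_ub _ r0); rewrite lee_fin; apply: opnorm_ge0.
  by apply: bounded_ops_C_quotient; exact: scale_tuple_open_ball.
(* As m bounds every quotient, the inequality with constant m^2 holds for all rA, rB, and the limit
   r -> 1 carries it to A, B. *)
rewrite lee_fin; apply/(iff _ m0) => s; apply: poisson_scale_lim => // r r01.
move: (S_ub r r01); rewrite lee_fin => /opnorm_C_quotient; apply=> //; exact: scale_tuple_open_ball.
Qed.
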